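(* Let $\rho>0$ and let $A,B\in\mathbb{R}^{n\times n}$ be in the block form described in the context. For $\epsilon>0$ let $\Delta(\lambda;\epsilon)=\det\left(\lambda I_n-A-B\,e^{-\lambda/\epsilon}\,\mathrm{sinhc}(\lambda\rho)\right)$; its zeros are called eigenvalues (for mean delay $\tau_{\rm m}=1/\epsilon$). Let $r$ be the number defined in the context. (i) Let $\lambda\in\mathcal{A}_+$. For any $0<\delta\le r$ there exists $0<\epsilon_0\le 1/\rho$ such that whenever $0<\epsilon<\epsilon_0$, the number of zeros of $\Delta(\cdot\,;\epsilon)$ in $\mathcal{B}_\delta(\lambda)$, counted with multiplicity, equals the multiplicity of $\lambda$ as an eigenvalue of $A$. (ii) Let $\lambda\in\mathcal{A}_-$. For any $0<\delta\le r$ there exists $0<\epsilon_0\le 1/\rho$ such that whenever $0<\epsilon<\epsilon_0$, the number of zeros of $\Delta(\cdot\,;\epsilon)$ in $\mathcal{B}_\delta(\lambda)$, counted with multiplicity, equals the multiplicity of $\lambda$ as an eigenvalue of $A_1$.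
   Context: The underlying delay differential equation is $u'(t)=A\,u(t)+\frac{B}{2\rho}\int_{\tau_{\rm m}-\rho}^{\tau_{\rm m}+\rho}u(t-s)\,ds$, $u(t)\in\mathbb{R}^n$, with mean delay $\tau_{\rm m}=1/\epsilon\ge\rho$; its characteristic equation is $\Delta(\lambda;\epsilon)=0$. Here $\mathrm{sinhc}(x)=\sinh(x)/x$ for $x\neq 0$ and $\mathrm{sinhc}(0)=1$. Block form: $B=\begin{bmatrix}0&0\\ 0&\bar B\end{bmatrix}$ with $\bar B\in\mathbb{R}^{d\times d}$ invertible, $1\le d\le n$, and correspondingly $A=\begin{bmatrix}A_1&A_2\\ A_3&A_4\end{bmatrix}$ with $A_1\in\mathbb{R}^{(n-d)\times(n-d)}$, $A_4\in\mathbb{R}^{d\times d}$ (if $d=n$, $A_1$ is empty and $\sigma(A_1)=\emptyset$). $\sigma(M)$ is the set of eigenvalues of a matrix $M$. $\mathcal{A}_+=\{\lambda\in\sigma(A):\Re\lambda>0\}$, $\mathcal{A}_-=\{\lambda\in\sigma(A_1):\Re\lambda<0\}$, $\mathcal{A}_s=\mathcal{A}_+\cup\mathcal{A}_-$. $r:=\frac13\min\{r_0,\operatorname{dist}(\mathcal{A}_s,i\mathbb{R})\}$ with $r_0:=\min\{|\lambda-\mu|:\lambda,\mu\in\mathcal{A}_s,\ \lambda\ne\mu\}$ (a minimum over the empty set is $+\infty$). $\mathcal{B}_\delta(\lambda)=\{z\in\mathbb{C}:|z-\lambda|<\delta\}$. *)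

(* Defs.v *)
From mathcomp Require Import all_boot all_order all_algebra.
From mathcomp Require Import all_classical all_reals all_analysis.
From mathcomp Require Import complex.

Set Implicit Arguments.
Unset Strict Implicit.
Unset Printing Implicit Defensive.

Import Order.TTheory GRing.Theory Num.Theory.
Import numFieldNormedType.Exports.

Local Open Scope classical_set_scope.
Local Open Scope ring_scope.
Local Open Scope complex_scope.

Section ComplexFunctions.
Variable R : realType.
Implicit Types z : R[i].

Definition cexp z : R[i] :=
  (expR (complex.Re z) * cos (complex.Im z)) +i*
  (expR (complex.Re z) * sin (complex.Im z)).

Definition csinh z : R[i] := (cexp z - cexp (- z)) / 2.

Definition csinhc z : R[i] := if z == 0 then 1 else csinh z / z.

(* The modulus is [Normc.normc], with values in [R]; [`|z|] on [R[i]] has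
   values in [R[i]]. *)
Definition cdisc z (delta : R) : set R[i] :=
  [set w | ComplexField.Normc.normc (w - z) < delta].

End ComplexFunctions.

(* Order of vanishing: f w = (w - z) ^+ k * g w near z, with g holomorphic near
   z and g z <> 0. When K is R[i], [derivable _ w 1] is complex
   differentiability at w. *)
Definition vanishing_order (K : numFieldType) (f : K -> K) (z : K) (k : nat) :
    Prop :=
  exists g : K -> K,
    [/\ \forall w \near z, derivable g w 1,
        g z != 0 &
        \forall w \near z, f w = (w - z) ^+ k * g w].

(* f has finitely many zeros in D, enumerated by s, all of finite order, and
   their orders add up to N. *)
Definition number_of_zeros (K : numFieldType) (f : K -> K) (D : set K)
    (N : nat) : Prop :=
  exists (s : seq K) (mu : K -> nat),
    [/\ uniq s,
        forall z, z \in s <-> D z /\ f z = 0,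
        forall z, z \in s -> vanishing_order f z (mu z) &
        (\sum_(z <- s) mu z)%N = N].

Section Spectrum.
Variable R : realType.

Definition cmx m n (M : 'M[R]_(m, n)) : 'M[R[i]]_(m, n) :=
  map_mx (fun x => x%:C) M.

Definition spectrum n (M : 'M[R]_n) : set R[i] :=
  [set z | eigenvalue (cmx M) z].

Definition alg_mult n (M : 'M[R]_n) (z : R[i]) : nat :=
  mup z (char_poly (cmx M)).

Definition spec_plus n (M : 'M[R]_n) : set R[i] :=
  [set z | spectrum M z /\ 0 < complex.Re z].

Definition spec_minus n (M : 'M[R]_n) : set R[i] :=
  [set z | spectrum M z /\ complex.Re z < 0].

(* Characteristic function of
     u'(t) = A u(t) + B / (2 rho) * \int_(1/eps - rho)^(1/eps + rho) u(t - s) ds: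
   averaging e^(- z s) over the delay window gives e^(- z / eps) sinhc(z rho). *)
Definition Delta n (A B : 'M[R]_n) (rho eps : R) (z : R[i]) : R[i] :=
  \det (z%:M - cmx A - (cexp (- z / eps%:C) * csinhc (z * rho%:C)) *: cmx B).

End Spectrum.

Section DiscRadius.
Variable R : realType.
Implicit Types S T : set R[i].

Definition imaginary_axis : set R[i] := [set z | complex.Re z = 0].

(* Infima in [\bar R], so that the infimum of the empty set is [+oo]. On a
   finite nonempty set an infimum is a minimum. *)
Definition cdist S T : \bar R :=
  ereal_inf [set (ComplexField.Normc.normc (p.1 - p.2))%:E | p in S `*` T].

Definition min_separation S : \bar R :=
  ereal_inf [set (ComplexField.Normc.normc (p.1 - p.2))%:E |
             p in [set p : R[i] * R[i] | [/\ S p.1, S p.2 & p.1 != p.2]]].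

Definition disc_radius S : \bar R :=
  ((3^-1)%:E * mine (min_separation S) (cdist S imaginary_axis))%E.

End DiscRadius.

(* Main.v *)
(** In the completion of the polynomials in [z - c] for the [l^1] norm of radius
    [r] (the Wiener algebra of the closed disc), division by [(z - c) ^+ n] is
    bounded, so a function [(z - c) ^+ n + h] with small [h] is, by Weierstrass
    preparation, a unit times a monic polynomial of degree [n] whose roots all
    lie in the open disc; this gives Hurwitz's theorem without contour integrals.
    On a disc in the right half plane, [w = e^(-z/eps) sinhc(z rho)] tends to [0]
    in this algebra and [det(z - A - w B)] tends to [det(z - A)].  On a disc in
    the left half plane, [v = 1/w] tends to [0] and [v^d det(z - A - w B)] tends
    to [det(z - A1) det(- Bbar)]. *)

(* Holomorphy enters only through division by [z - z0]. In the supremum norm a bound for the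
   quotient rests on Cauchy's formula or the maximum principle; in the [l^1] norm it follows from
   synthetic division of polynomials. Both half planes use one perturbation statement: a polynomial
   in a small parameter and [z] is its constant coefficient plus the parameter times a factor
   bounded uniformly, so only the norm of the parameter has to be small. On the left [w] blows up,
   but it meets only the [d] rows of [Bbar]; multiplying those rows by [v] leaves a polynomial in
   [v], and the factor [v ^+ d] has no zeros, so it changes no multiplicity. The price is that
   [sinhc] must be inverted in the algebra. The bound on [delta] supplies two geometric facts: the
   closed disc stays off the imaginary axis, which makes the parameter decay exponentially in
   [1/eps], and [lambda] is the only root of the limit polynomial in that disc. *)
Require Import Defs.
From mathcomp Require Import all_boot all_order all_algebra.
From mathcomp Require Import all_classical all_reals all_analysis.
From mathcomp Require Import complex.
From mathcomp Require Import ring.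

Import Order.TTheory GRing.Theory Num.Theory.
Import numFieldNormedType.Exports.

Local Open Scope classical_set_scope.
Local Open Scope ring_scope.
Local Open Scope complex_scope.

Set Implicit Arguments.
Unset Strict Implicit.
Unset Printing Implicit Defensive.

(** * Absolutely convergent series and the norm of a polynomial *)

Section Limits.
Variable K : numFieldType.
Implicit Types (u : nat -> K) (l e M : K).

Lemma cvgn_normP u l :
  (forall e, 0 < e -> exists N, forall n, (N <= n)%N -> `|l - u n| <= e) <->
  u n @[n --> \oo] --> l.
Proof.
split=> [H|/cvgrPdist_le H e e0].
  by apply/cvgrPdist_le => e /H [N HN]; exists N.
by have [N _ HN] := H e e0; exists N => n; exact: HN.
Qed.

Lemma cvgn_norm_le u l M :
  u n @[n --> \oo] --> l -> (forall n, `|u n| <= M) -> `|l| <= M.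
Proof.
move=> /cvgn_normP ul uM; apply/ler_addgt0Pr => e /ul [N /(_ N (leqnn N)) HN].
by rewrite -(subrK (u N) l) (le_trans (ler_normD _ _))// addrC lerD.
Qed.

Lemma cvgn_uniq u l l' :
  u n @[n --> \oo] --> l -> u n @[n --> \oo] --> l' -> l = l'.
Proof. exact: cvg_unique. Qed.

Lemma cvgn_sumr (I : Type) (s : seq I) (a : I -> nat -> K) (b : I -> K) :
  (forall i, a i n @[n --> \oo] --> b i) ->
  \sum_(i <- s) a i n @[n --> \oo] --> \sum_(i <- s) b i.
Proof.
move=> ab; elim: s => [|i s IH].
  by under eq_fun do rewrite big_nil; rewrite big_nil; exact: cvg_cst.
by under eq_fun do rewrite big_cons; rewrite big_cons; exact: cvgD.
Qed.

End Limits.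

(** Completeness in the only form needed. Bounds are elements of [K], since the norm of [R[i]] has
    values in [R[i]]; [complex_summable_cvg] provides the instance. *)
Definition summable_cvg (K : numFieldType) : Prop :=
  forall (a : nat -> K) (M : K), (forall n, \sum_(i < n) `|a i| <= M) ->
  exists l : K, \sum_(i < n) a i @[n --> \oo] --> l.

Section SummableCvg.
Variable K : numFieldType.
Hypothesis Kcvg : summable_cvg K.

Lemma ge0_sum_tail (b : nat -> K) (M : K) : (forall i, 0 <= b i) ->
  (forall n, \sum_(i < n) b i <= M) -> forall e, 0 < e ->
  exists J, forall n, (J <= n)%N -> \sum_(J <= i < n) b i <= e.
Proof.
move=> b0 bM e e0.
have [|L /cvgn_normP bL] := Kcvg (a := b) (M := M).
  by move=> n; under eq_bigr do rewrite ger0_norm //.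
have e20 : 0 < e / 2 by rewrite divr_gt0.
have [J HJ] := bL _ e20.
exists J => n Jn.
rewrite -[leLHS]ger0_norm ?sumr_ge0//.
have -> : \sum_(J <= i < n) b i =
    (L - \sum_(i < J) b i) - (L - \sum_(i < n) b i).
  rewrite -!(big_mkord xpredT b) (big_cat_nat (leq0n J) Jn)//=; ring.
rewrite (le_trans (ler_normB _ _))// (splitr e) lerD//; exact: HJ.
Qed.

(** Tannery's theorem on the diagonal, [n] being both truncation and parameter: beyond some [J] the
    majorant [b] is small, and below [J] there are finitely many null sequences. *)
Lemma dominated_series_cvg0 (a : nat -> nat -> K) (b : nat -> K) (M : K) :
  (forall j n, `|a j n| <= b j) -> (forall n, \sum_(i < n) b i <= M) ->
  (forall j, a j n @[n --> \oo] --> (0 : K)) ->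
  \sum_(j < n) a j n @[n --> \oo] --> (0 : K).
Proof.
move=> ab bM a0; apply/cvgn_normP => e e0.
have b0 i : 0 <= b i by exact: le_trans (ab i 0%N).
have e20 : 0 < e / 2 by rewrite divr_gt0.
have [J HJ] := ge0_sum_tail b0 bM e20.
have /cvgn_normP/(_ _ e20)[N HN] := @cvgn_sumr _ _ (iota 0 J) _ _ a0.
exists (maxn J N) => n; rewrite geq_max => /andP[Jn Nn].
rewrite -(big_mkord xpredT (fun j => a j n)) (big_cat_nat (leq0n J) Jn)//=.
rewrite sub0r normrN.
rewrite (le_trans (ler_normD _ _))// (splitr e) lerD//.
  by have := HN n Nn; rewrite big1 ?sub0r ?normrN // /index_iota subn0.
rewrite (le_trans (ler_norm_sum _ _ _))// (le_trans _ (HJ _ Jn))//.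
by apply: ler_sum.
Qed.

End SummableCvg.

Section PolyNorm.
Variables (K : numFieldType) (r : K).
Hypothesis r0 : 0 <= r.
Implicit Types (p q : {poly K}) (z : K).

Definition pnorm p : K := \sum_(i < size p) `|p`_i| * r ^+ i.

Lemma pnorm_widen n p : (size p <= n)%N ->
  pnorm p = \sum_(i < n) `|p`_i| * r ^+ i.
Proof.
move=> pn; rewrite /pnorm (big_ord_widen n (fun i => `|p`_i| * r ^+ i))//.
rewrite big_mkcond; apply: eq_bigr => i _; case: ifPn => //.
by rewrite -leqNgt => /(nth_default 0) ->; rewrite normr0 mul0r.
Qed.

Lemma pnorm_ge0 p : 0 <= pnorm p.
Proof. by apply: sumr_ge0 => i _; rewrite mulr_ge0 ?exprn_ge0. Qed.

Lemma pnormD p q : pnorm (p + q) <= pnorm p + pnorm q.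
Proof.
set n := maxn (size p) (size q).
rewrite (@pnorm_widen n (p + q)) ?size_polyD//.
rewrite (@pnorm_widen n p) ?leq_maxl// (@pnorm_widen n q) ?leq_maxr//.
rewrite -big_split /=; apply: ler_sum => i _.
by rewrite -mulrDl coefD ler_wpM2r ?exprn_ge0 ?ler_normD.
Qed.

Lemma pnormC a : pnorm a%:P = `|a|.
Proof.
by rewrite (@pnorm_widen 1) ?size_polyC ?leq_b1// big_ord1 coefC mulr1.
Qed.

Lemma pnorm0 : pnorm 0 = 0.
Proof. by rewrite -polyC0 pnormC normr0. Qed.

Lemma pnorm_cons p a : pnorm (p * 'X + a%:P) = pnorm p * r + `|a|.
Proof.
rewrite (@pnorm_widen (size p).+1); last first.
  rewrite (leq_trans (size_polyD _ _))// geq_max size_polyC.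
  rewrite (leq_trans (leq_b1 _))// andbT.
  by rewrite (leq_trans (size_polyMleq _ _))// size_polyX addn2.
rewrite big_ord_recl coefD coefMX coefC /= add0r mulr1 addrC; congr (_ + _).
rewrite /pnorm mulr_suml; apply: eq_bigr => i _.
by rewrite coefD coefMX coefC /= addr0 exprSr mulrA.
Qed.

Lemma pnormMX p : pnorm (p * 'X) = pnorm p * r.
Proof. by have := pnorm_cons p 0; rewrite addr0 normr0 addr0. Qed.

Lemma pnormXn n : pnorm 'X^n = r ^+ n.
Proof.
elim: n => [|n IH]; first by rewrite expr0 -polyC1 pnormC normr1.
by rewrite exprSr pnormMX IH -exprSr.
Qed.

Lemma pnormZ a p : pnorm (a *: p) = `|a| * pnorm p.
Proof.
rewrite (@pnorm_widen (size p)) ?size_scale_leq// /pnorm mulr_sumr.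
by apply: eq_bigr => i _; rewrite coefZ normrM mulrA.
Qed.

Lemma pnormM p q : pnorm (p * q) <= pnorm p * pnorm q.
Proof.
elim/poly_ind: p => [|p a IH]; first by rewrite mul0r pnorm0 mul0r.
rewrite mulrDl mulrAC (le_trans (pnormD _ _))// pnormMX mul_polyC pnormZ.
by rewrite pnorm_cons mulrDl lerD// mulrAC ler_wpM2r.
Qed.

Lemma pnorm_sum (I : Type) (s : seq I) (F : I -> {poly K}) :
  pnorm (\sum_(i <- s) F i) <= \sum_(i <- s) pnorm (F i).
Proof.
elim: s => [|i s IH]; first by rewrite !big_nil pnorm0.
by rewrite !big_cons (le_trans (pnormD _ _))// lerD2l.
Qed.

Lemma norm_horner_le p z : `|z| <= r -> `|p.[z]| <= pnorm p.
Proof.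
move=> zr; rewrite horner_coef (le_trans (ler_norm_sum _ _ _))//.
apply: ler_sum => i _; rewrite normrM ler_wpM2l// normrX.
by rewrite lerXn2r ?nnegrE.
Qed.

(* Division by [X - z0] is bounded for the norm: this replaces Cauchy's
   estimates. *)
Lemma pnorm_divXsubC p z0 : `|z0| < r -> exists q,
  p = p.[z0]%:P + ('X - z0%:P) * q /\ pnorm q <= pnorm p / (r - `|z0|).
Proof.
move=> z0r; have d0 : 0 < r - `|z0| by rewrite subr_gt0.
elim/poly_ind: p => [|p a [q [pq qp]]].
  by exists 0; rewrite horner0 mulr0 addr0 pnorm0 mul0r.
(* Horner's scheme: [p * 'X + a] is [('X - z0) * p + z0 * p + a], and [z0 * p] is divided by the
   induction hypothesis. The norms add up to [r * pnorm p / (r - |z0|)]. *)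
exists (p + z0 *: q); split.
  rewrite !hornerE polyCD polyCM -mul_polyC.
  have -> : ('X - z0%:P) * (p + z0%:P * q) =
      ('X - z0%:P) * p + z0%:P * (p - p.[z0]%:P).
    by rewrite {3}pq; ring.
  ring.
rewrite (le_trans (pnormD _ _))// pnormZ pnorm_cons.
rewrite (@le_trans _ _ (pnorm p + `|z0| * (pnorm p / (r - `|z0|))))//.
  by rewrite lerD2l ler_wpM2l.
rewrite ler_pdivlMr// mulrDl -mulrA mulfVK ?gt_eqF//.
by rewrite mulrBr [_ * pnorm p]mulrC subrK lerDl.
Qed.

End PolyNorm.

(** * The Wiener algebra of a disc *)

(** Enumerates a double series by growing squares: the last bracket is the border added to the
    square of side [n]. *)
Lemma sum_boxS (V : zmodType) (a : nat -> nat -> V) n :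
  \sum_(j < n.+1) \sum_(i < n.+1) a j i =
  \sum_(j < n) \sum_(i < n) a j i +
  (\sum_(i < n.+1) a n i + \sum_(j < n) a j n).
Proof.
rewrite big_ord_recr /= [X in _ = _ + X]addrC addrA -big_split; congr (_ + _).
by apply: eq_bigr => j _; rewrite big_ord_recr.
Qed.

Section Wiener.
Variables (K : numFieldType) (c r : K).
Hypotheses (Kcvg : summable_cvg K) (r0 : 0 < r).
Implicit Types (f g h : K -> K) (p q : {poly K}) (z M N : K).

(* The completion of the polynomials in [z - c] for [pnorm r]: the functions
   with a power series at [c] that converges absolutely on the closed disc of
   radius [r], with [l^1] norm at most [M]. *)
Definition wiener f M : Prop :=
  exists p : nat -> {poly K}, (forall n, \sum_(i < n) pnorm r (p i) <= M) /\
    forall z, `|z - c| <= r -> \sum_(i < n) (p i).[z - c] @[n --> \oo] --> f z.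

Let r_ge0 : 0 <= r := ltW r0.

Lemma wiener_ext f g M : (forall z, `|z - c| <= r -> f z = g z) ->
  wiener f M -> wiener g M.
Proof.
move=> fg [p [pM pf]]; exists p; split=> [//|z zr].
by rewrite -fg//; exact: pf.
Qed.

Lemma wiener_le f M N : M <= N -> wiener f M -> wiener f N.
Proof.
by move=> MN [p [pM pf]]; exists p; split=> // n; rewrite (le_trans (pM n)).
Qed.

Lemma wiener_ge0 f M : wiener f M -> 0 <= M.
Proof. by move=> [p [/(_ 0%N) + _]]; rewrite big_ord0. Qed.

Lemma wiener_poly p : wiener (fun z => p.[z - c]) (pnorm r p).
Proof.
exists (fun i => if i == 0%N then p else 0); split=> [[|n]|z zr].
- by rewrite big_ord0 pnorm_ge0.
- by rewrite big_ord_recl /= big1 ?addr0// => i _; rewrite pnorm0.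
- apply/cvgn_normP => e e0; exists 1%N => -[//|n] _.
  rewrite big_ord_recl /= big1 ?addr0 ?subrr ?normr0 ?ltW//.
  by move=> i _; rewrite horner0.
Qed.

Lemma wiener_cst (a : K) : wiener (fun=> a) `|a|.
Proof.
have := wiener_poly a%:P; rewrite pnormC; apply: wiener_ext => z _.
by rewrite hornerC.
Qed.

Lemma wiener_norm_le f M z : wiener f M -> `|z - c| <= r -> `|f z| <= M.
Proof.
move=> [p [pM pf]] zr; apply: cvgn_norm_le (pf z zr) _ => n.
rewrite (le_trans (ler_norm_sum _ _ _))// (le_trans _ (pM n))//.
by apply: ler_sum => i _; exact: norm_horner_le.
Qed.

Lemma wienerD f g M N : wiener f M -> wiener g N ->
  wiener (fun z => f z + g z) (M + N).
Proof.
move=> [p [pM pf]] [q [qN qg]]; exists (fun i => p i + q i); split=> [n|z zr].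
  rewrite (le_trans _ (lerD (pM n) (qN n)))// -big_split /=.
  by apply: ler_sum => i _; exact: pnormD.
under eq_fun do under eq_bigr do rewrite hornerD.
by under eq_fun do rewrite big_split /=; apply: cvgD; [exact: pf|exact: qg].
Qed.

Lemma wienerM f g M N : wiener f M -> wiener g N ->
  wiener (fun z => f z * g z) (M * N).
Proof.
move=> [p [pM pf]] [q [qN qg]].
pose s (u : nat -> {poly K}) n := \sum_(i < n) u i.
(* Borders of squares instead of a Cauchy product: the partial sums of [t] are exactly the products
   of the partial sums. *)
pose t n := p n * s q n.+1 + s p n * q n.
have st n : \sum_(i < n) t i = s p n * s q n.
  elim: n => [|n IH]; first by rewrite /s !big_ord0 mul0r.
  by rewrite big_ord_recr /= IH /t /s !big_ord_recr /=; ring.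
exists t; split=> [n|z zr].
  pose a (u : nat -> {poly K}) n := \sum_(i < n) pnorm r (u i).
  have sa u k : pnorm r (s u k) <= a u k by exact: pnorm_sum.
  have a_ge0 u k : 0 <= a u k by apply: sumr_ge0 => i _; exact: pnorm_ge0.
  apply: (@le_trans _ _ (a p n * a q n)); last first.
    by apply: ler_pM; rewrite ?a_ge0 ?pM ?qN.
  elim: n => [|n IH]; first by rewrite /a !big_ord0 mul0r.
  rewrite big_ord_recr /= (le_trans (lerD IH (lexx _)))//.
  have -> : a p n.+1 * a q n.+1 =
      a p n * a q n + (pnorm r (p n) * a q n.+1 + a p n * pnorm r (q n)).
    by rewrite /a !big_ord_recr /=; ring.
  rewrite lerD2l (le_trans (pnormD _ _ _))// lerD//.
    by rewrite (le_trans (pnormM _ _ _))// ler_wpM2l ?pnorm_ge0.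
  by rewrite (le_trans (pnormM _ _ _))// ler_wpM2r ?pnorm_ge0.
under eq_fun do rewrite -horner_sum st hornerM /s !horner_sum.
by apply: cvgM; [exact: pf|exact: qg].
Qed.

Lemma wienerZ (a : K) f M : wiener f M -> wiener (fun z => a * f z) (`|a| * M).
Proof. by apply: wienerM; exact: wiener_cst. Qed.

Lemma wienerX f M n : wiener f M -> wiener (fun z => f z ^+ n) (M ^+ n).
Proof.
move=> fM; elim: n => [|n IH].
  by have := wiener_cst 1; rewrite normr1; exact: wiener_ext.
rewrite exprS; apply: wiener_ext (wienerM fM IH) => z _.
by rewrite exprS.
Qed.

(** Completeness of the algebra. The double series of polynomials is regrouped by borders of
    squares, which costs nothing in norm. *)
Lemma wiener_series (f : nat -> K -> K) (m : nat -> K) F M :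
  (forall j, wiener (f j) (m j)) -> (forall n, \sum_(j < n) m j <= M) ->
  (forall z, `|z - c| <= r -> \sum_(j < n) f j z @[n --> \oo] --> F z) ->
  wiener F M.
Proof.
move=> /choice[p pP] mM fF.
have m0 j : 0 <= m j by rewrite (le_trans _ ((pP j).1 0%N))// big_ord0.
pose t n := \sum_(i < n.+1) p n i + \sum_(j < n) p j n.
have tE n : \sum_(i < n) t i = \sum_(j < n) \sum_(i < n) p j i.
  elim: n => [|n IH]; first by rewrite !big_ord0.
  by rewrite sum_boxS -IH big_ord_recr.
exists t; split=> [n|z zr].
  rewrite (le_trans _ (mM n))//.
  apply: (@le_trans _ _ (\sum_(j < n) \sum_(i < n) pnorm r (p j i))); last first.
    by apply: ler_sum => j _; exact: (pP j).1.
  elim: n => [|n IH]; first by rewrite !big_ord0.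
  rewrite (sum_boxS (fun j i => pnorm r (p j i))) big_ord_recr lerD//=.
  by rewrite (le_trans (pnormD _ _ _))// lerD// pnorm_sum.
(* The square sum differs from the partial sum of the [f j z] by these remainders, each null in [n]
   and dominated by [2 * m j]. *)
pose a j n := f j z - \sum_(i < n) (p j i).[z - c].
have a_le j n : `|a j n| <= m j + m j.
  rewrite (le_trans (ler_normB _ _))// lerD//.
    by apply: wiener_norm_le zr; exists (p j).
  rewrite (le_trans (ler_norm_sum _ _ _))// (le_trans _ ((pP j).1 n))//.
  by apply: ler_sum => i _; exact: norm_horner_le.
have a0 j : a j n @[n --> \oo] --> (0 : K).
  rewrite -(subrr (f j z)); apply: cvgB; first exact: cvg_cst.
  exact: (pP j).2.
have mmM n : \sum_(j < n) (m j + m j) <= M + M by rewrite big_split lerD.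
have L : \sum_(j < n) f j z - \sum_(j < n) a j n @[n --> \oo] --> F z - 0.
  by apply: cvgB; [exact: fF|exact: dominated_series_cvg0 a_le mmM a0].
rewrite subr0 in L.
rewrite (_ : (fun n => _) = (fun n => \sum_(j < n) f j z - \sum_(j < n) a j n))//.
apply/funext => n; rewrite -horner_sum tE horner_sum -sumrB.
by apply: eq_bigr => j _; rewrite /a subKr horner_sum.
Qed.

End Wiener.

Lemma near_normB_lt (K : numFieldType) (c r z0 : K) : `|z0 - c| < r ->
  \forall z \near z0, `|z - c| < r.
Proof.
move=> z0r; have d0 : 0 < r - `|z0 - c| by rewrite subr_gt0.
near=> z.
have : `|z0 - z| < r - `|z0 - c| by near: z; apply: (@cvgr_dist_lt _ K _ _ _ id z0).
rewrite ltrBrDr distrC; apply: le_lt_trans.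
by rewrite (le_trans _ (ler_normD _ _))// addrA subrK.
Unshelve. all: by end_near. Qed.

(** Caratheodory's criterion; the derivative is [g z0]. *)
Lemma derivable_factor (K : numFieldType) (f g : K -> K) (z0 : K) :
  (\forall z \near z0, f z = f z0 + (z - z0) * g z) ->
  g z @[z --> z0] --> g z0 -> derivable f z0 1.
Proof.
move=> fg gc; apply/cvg_ex; exists (g z0).
apply/cvgrPdist_le => e e0.
have H : \forall z \near z0, f z = f z0 + (z - z0) * g z /\ `|g z0 - g z| <= e.
  near=> z; split; first by near: z.
  by near: z; move/cvgrPdist_le : gc; exact.
rewrite (near_shift 0) subr0 in H.
near=> h; have h0 : h != 0 by near: h; exact: nbhs_dnbhs_neq.
have [fh gh] : f (h + z0) = f z0 + (h + z0 - z0) * g (h + z0) /\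
  `|g z0 - g (h + z0)| <= e by near: h; exact: (@nbhs_dnbhs K).
by rewrite /= [h *: 1]mulr1 fh addrAC subrr add0r addrK [_ *: _]mulrA mulVf// mul1r.
Unshelve. all: by end_near. Qed.

(** * Division by [z - z0] in the algebra, and holomorphy of its elements *)

Section Division.
Variables (K : numFieldType) (c r : K).
Hypotheses (Kcvg : summable_cvg K) (r0 : 0 < r).
Implicit Types (f g h : K -> K) (p q : {poly K}) (z M N : K).
Notation wiener := (wiener c r).

Let r_ge0 : 0 <= r := ltW r0.

Lemma wiener_divXsubC f M z0 : `|z0 - c| < r -> wiener f M -> exists g,
  wiener g (M / (r - `|z0 - c|)) /\
  forall z, `|z - c| <= r -> f z = f z0 + (z - z0) * g z.
Proof.
move=> z0r [p [pM pf]].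
have d0 : 0 < r - `|z0 - c| by rewrite subr_gt0.
have [q qP] := choice (fun i => pnorm_divXsubC r_ge0 (p i) z0r).
have qM n : \sum_(i < n) pnorm r (q i) <= M / (r - `|z0 - c|).
  rewrite ler_pdivlMr// (le_trans _ (pM n))// mulr_suml.
  by apply: ler_sum => i _; rewrite -ler_pdivlMr// (qP i).2.
(* The implication sits under the existential so that [choice] yields a total function, with
   arbitrary values off the closed disc. *)
have lim_q : forall z : K, exists l : K, `|z - c| <= r ->
    \sum_(i < n) (q i).[z - c] @[n --> \oo] --> l.
  move=> z; have [zr|_] := boolP (`|z - c| <= r); last by exists 0.
  have [|l ql] := Kcvg (a := fun i => (q i).[z - c]) (M := M / (r - `|z0 - c|)).
    move=> n; rewrite (le_trans _ (qM n))//.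
    by apply: ler_sum => i _; exact: norm_horner_le.
  by exists l.
have [g gP] := choice lim_q; exists g; split; first by exists q.
move=> z zr; apply: cvgn_uniq (pf z zr) _.
rewrite (_ : (fun n => _) =
  (fun n => \sum_(i < n) (p i).[z0 - c] + (z - z0) * \sum_(i < n) (q i).[z - c])).
  apply: cvgD; first exact: pf (ltW z0r).
  by apply: cvgM; [exact: cvg_cst|exact: gP].
apply/funext => n; rewrite mulr_sumr -big_split /=; apply: eq_bigr => i _.
by rewrite [in LHS](qP i).1 !hornerE opprB addrA subrK.
Qed.

Lemma wiener_continuous f M z0 : `|z0 - c| < r -> wiener f M ->
  f z @[z --> z0] --> f z0.
Proof.
move=> z0r /(wiener_divXsubC z0r)[g [gM fg]].
set M' := M / _ in gM; have M'0 := wiener_ge0 gM.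
apply/(@cvgrPdist_le K K _ (nbhs z0)) => e e0; near=> z.
have zr : `|z - c| <= r by apply/ltW; near: z; exact: near_normB_lt.
(* By the factorization [f] is Lipschitz at [z0] with constant [M']; the [+ 1] covers [M' = 0]. *)
have ze : `|z0 - z| <= e / (M' + 1).
  near: z; apply: (@cvgr_dist_le _ K _ _ _ id z0) => //.
  by rewrite divr_gt0// ltr_wpDl.
rewrite (fg z zr) opprD addrA subrr sub0r normrN normrM distrC.
rewrite (le_trans (ler_pM _ _ ze (wiener_norm_le r0 gM zr)))//.
rewrite mulrAC ler_pdivrMr ?ltr_wpDl// ler_wpM2l ?ltW//.
by rewrite ltrDl.
Unshelve. all: by end_near. Qed.

Lemma wiener_derivable f M z0 : `|z0 - c| < r -> wiener f M ->
  derivable f z0 1.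
Proof.
move=> z0r /(wiener_divXsubC z0r)[g [gM fg]].
apply: derivable_factor (wiener_continuous z0r gM).
by near=> z; apply/fg/ltW; near: z; exact: near_normB_lt.
Unshelve. all: by end_near. Qed.

(** Taylor expansion by [n] divisions at the centre, each costing a factor [1 / r]. Each coefficient
    of [R], weighted by its power of [r], is at most [M], whence [n%:R * M]. *)
Lemma wiener_divXn n f M : wiener f M -> exists (R : {poly K}) g,
  [/\ (size R <= n)%N, pnorm r R <= n%:R * M, wiener g (M / r ^+ n) &
      forall z, `|z - c| <= r -> f z = R.[z - c] + (z - c) ^+ n * g z].
Proof.
have cr : `|c - c| < r by rewrite subrr normr0.
elim: n f M => [|n IH] f M fM.
  exists 0, f; split=> [| | |z _]; rewrite ?size_poly0 ?pnorm0 ?mul0r//.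
    by rewrite expr0 divr1.
  by rewrite horner0 add0r expr0 mul1r.
have [g1 []] := wiener_divXsubC cr fM.
rewrite subrr normr0 subr0 => /IH[R [g [sR RM gM g1E]]] fg1.
exists (R * 'X + (f c)%:P), g; split=> [| | |z zr].
- rewrite (leq_trans (size_polyD _ _))// geq_max size_polyC.
  rewrite (leq_trans (leq_b1 _))// andbT.
  by rewrite (leq_trans (size_polyMleq _ _))// size_polyX addn2.
- rewrite pnorm_cons mulrSr mulrDl mul1r lerD//; last first.
    by apply: wiener_norm_le fM _ => //; exact: ltW.
  by rewrite -ler_pdivlMr// -mulrA.
- by rewrite exprS invfM mulrA.
- by rewrite fg1// g1E// !hornerE exprS; ring.
Qed.

End Division.

(** * Geometric series and inverses in the algebra *)

Section Geometric.
Variable K : numFieldType.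
Hypothesis Kcvg : summable_cvg K.

Lemma sum_geometric_le (k : K) n : 0 <= k < 1 ->
  \sum_(i < n) k ^+ i <= (1 - k)^-1.
Proof.
move=> /andP[k0 k1]; have d0 : 0 < 1 - k by rewrite subr_gt0.
rewrite -[leRHS]mul1r ler_pdivlMr// mulrC -[1 - k]opprB mulNr -subrX1 opprB.
by rewrite gerBl exprn_ge0.
Qed.

(** [K] is not assumed Archimedean: the powers tend to 0 as the terms of a convergent geometric
    series. *)
Lemma cvgn_expr0 (k : K) : 0 <= k < 1 -> k ^+ n @[n --> \oo] --> (0 : K).
Proof.
move=> k01; have /andP[k0 k1] := k01.
have [|l kl] := Kcvg (a := fun n => k ^+ n) (M := (1 - k)^-1).
  move=> n; under eq_bigr do rewrite ger0_norm ?exprn_ge0//.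
  exact: sum_geometric_le.
apply: (@cvg_series_cvg_0 K K); apply/cvg_ex; exists l.
by rewrite /series /=; under eq_fun do rewrite big_mkord.
Qed.

End Geometric.

Section Inverse.
Variables (K : numFieldType) (c r : K).
Hypotheses (Kcvg : summable_cvg K) (r0 : 0 < r).
Notation wiener := (wiener c r).

(** Neumann series. *)
Lemma wiener_inv1B u k : wiener u k -> k < 1 ->
  wiener (fun z => (1 - u z)^-1) (1 - k)^-1.
Proof.
move=> uk k1; have k0 := wiener_ge0 uk; have k01 : 0 <= k < 1 by rewrite k0.
apply: (@wiener_series _ _ _ Kcvg r0 (fun j z => u z ^+ j) (fun j => k ^+ j)).
- by move=> j; exact: wienerX.
- by move=> n; exact: sum_geometric_le.
move=> z zr; have ukz := wiener_norm_le r0 uk zr.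
have u1 : 1 - u z != 0.
  apply/eqP => /eqP; rewrite subr_eq0 => /eqP u1.
  by move: (le_lt_trans ukz k1); rewrite -u1 normr1 ltxx.
apply/cvgn_normP => e e0.
have u1_gt0 : 0 < `|1 - u z| by rewrite normr_gt0.
have /cvgn_normP/(_ _ (mulr_gt0 e0 u1_gt0))[N HN] := cvgn_expr0 Kcvg k01.
exists N => n Nn; rewrite -[X in `|X|](mulfK u1) normrM normfV ler_pdivrMr//.
have -> : ((1 - u z)^-1 - \sum_(i < n) u z ^+ i) * (1 - u z) = u z ^+ n.
  rewrite mulrBl mulVf// mulrC -[1 - u z]opprB mulNr -subrX1; ring.
rewrite (le_trans _ (HN n Nn))// sub0r normrN !normrX lerXn2r ?nnegrE//.
by rewrite (ger0_norm k0).
Qed.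

(** [z - mu] is [- (mu - c)] times [1 - (z - c) / (mu - c)], and the last quotient has norm
    [r / |mu - c| < 1]. *)
Lemma wiener_invXsubC mu : r < `|mu - c| ->
  exists M, wiener (fun z => (z - mu)^-1) M.
Proof.
move=> rmu; have m0 : mu - c != 0 by rewrite -normr_gt0 (lt_trans r0).
have := wienerZ r0 (mu - c)^-1 (wiener_poly c r0 'X).
have -> : pnorm r 'X = r by rewrite -[X in pnorm _ X]expr1 pnormXn.
rewrite normfV mulrC => /wiener_inv1B /=.
rewrite ltr_pdivrMr ?mul1r ?(lt_trans r0)// => /(_ rmu).
move=> /(wienerZ r0 (- (mu - c)^-1)) H; eexists; apply: wiener_ext H => z _ /=.
rewrite hornerX -[- _]invrN -invfM; congr (_^-1).
by rewrite mulrBr mulr1 mulNr mulVKf// ; ring.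
Qed.

End Inverse.

Lemma wiener_inv_poly (K : numClosedFieldType) (c r : K) (P : {poly K}) :
  summable_cvg K -> 0 < r -> P != 0 ->
  (forall mu, root P mu -> r < `|mu - c|) ->
  exists M, wiener c r (fun z => P.[z]^-1) M.
Proof.
move=> Kcvg r0 P0 rP; have [s Ps] := closed_field_poly_normal P.
have lP : lead_coef P != 0 by rewrite lead_coef_eq0.
have {rP} : all (fun mu => r < `|mu - c|) s.
  by apply/allP => mu mus; apply: rP; rewrite Ps rootZ// root_prod_XsubC.
move=> sr; suff [M MP] : exists M,
    wiener c r (fun z => (\prod_(mu <- s) ('X - mu%:P)).[z]^-1) M.
  exists (`|(lead_coef P)^-1| * M); apply: wiener_ext (wienerZ r0 _ MP) => z _.
  by rewrite [in RHS]Ps hornerZ invfM.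
elim: s sr {Ps} => [_|mu s IH /= /andP[rmu /IH[M MP]]].
  exists `|1|; apply: wiener_ext (wiener_cst c r0 1) => z _.
  by rewrite big_nil hornerC invr1.
have [N NP] := wiener_invXsubC Kcvg r0 rmu.
exists (N * M); apply: wiener_ext (wienerM r0 NP MP) => z _.
by rewrite big_cons hornerM hornerXsubC invfM.
Qed.

(** * Weierstrass preparation and Hurwitz's theorem *)

Lemma coef_pnorm_le (K : numFieldType) (r : K) (p : {poly K}) i :
  0 <= r -> `|p`_i| * r ^+ i <= pnorm r p.
Proof.
move=> r0; have [ip|pi] := ltnP i (size p); last first.
  by rewrite nth_default// normr0 mul0r pnorm_ge0.
rewrite /pnorm (bigD1 (Ordinal ip))//= lerDl.
by apply: sumr_ge0 => j _; rewrite mulr_ge0 ?exprn_ge0.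
Qed.

(** Outside the disc [(|z| / r) ^+ i] increases with [i]. This will keep the roots of ['X^n + R]
    inside the disc. *)
Lemma norm_horner_le_out (K : numFieldType) (r : K) (p : {poly K}) n z :
  0 < r -> (size p <= n)%N -> r <= `|z| ->
  `|p.[z]| <= pnorm r p * (`|z| / r) ^+ n.
Proof.
move=> r0 pn rz; have r0' := ltW r0.
rewrite (horner_coef_wide _ pn) (pnorm_widen _ pn) mulr_suml.
rewrite (le_trans (ler_norm_sum _ _ _))//; apply: ler_sum => i _.
rewrite normrM normrX -mulrA ler_wpM2l//.
rewrite -[leLHS](@mulfVK _ (r ^+ i)) ?expf_neq0 ?gt_eqF// mulrC.
rewrite ler_wpM2l ?exprn_ge0// -expr_div_n ler_weXn2l//; last exact: ltnW.
by rewrite ler_pdivlMr ?mul1r.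
Qed.

(** With degrees bounded by [n], the limit can be taken coefficient by coefficient and is again a
    polynomial, so it can be evaluated outside the disc. *)
Lemma poly_series_cvg (K : numFieldType) (r : K) (p : nat -> {poly K}) n M :
  summable_cvg K -> 0 < r ->
  (forall k, size (p k) <= n)%N -> (forall m, \sum_(k < m) pnorm r (p k) <= M) ->
  exists q : {poly K}, [/\ (size q <= n)%N,
    forall z, \sum_(k < m) (p k).[z] @[m --> \oo] --> q.[z] &
    forall z, r <= `|z| -> `|q.[z]| <= M * (`|z| / r) ^+ n].
Proof.
move=> Kcvg r0 pn pM.
have lim_coef : forall i : nat, exists l : K,
    \sum_(k < m) (p k)`_i @[m --> \oo] --> l.
  move=> i; apply: (Kcvg (fun k => (p k)`_i) (M / r ^+ i)) => m.
  rewrite ler_pdivlMr ?exprn_gt0// (le_trans _ (pM m))// mulr_suml.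
  by apply: ler_sum => k _; exact/coef_pnorm_le/ltW.
have [a aP] := choice lim_coef.
have pz z : \sum_(k < m) (p k).[z] @[m --> \oo] --> (\poly_(i < n) a i).[z].
  rewrite horner_poly.
  rewrite (_ : (fun m => _) =
      (fun m => \sum_(i < n) (\sum_(k < m) (p k)`_i) * z ^+ i)).
    apply: cvgn_sumr => i; apply: cvgM; [exact: aP|exact: cvg_cst].
  apply/funext => m; under [RHS]eq_bigr do rewrite mulr_suml.
  rewrite exchange_big /=; apply: eq_bigr => k _.
  by rewrite (horner_coef_wide _ (pn k)).
exists (\poly_(i < n) a i); split=> [|//|z rz]; first exact: size_poly.
apply: cvgn_norm_le (pz z) _ => m.
have t0 : 0 <= (`|z| / r) ^+ n by rewrite exprn_ge0// divr_ge0// ltW.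
rewrite (le_trans (ler_norm_sum _ _ _))// (le_trans _ (ler_wpM2r t0 (pM m)))//.
by rewrite mulr_suml; apply: ler_sum => k _; exact: norm_horner_le_out.
Qed.

Section Weierstrass.
Variables (K : numFieldType) (c r : K).
Hypotheses (Kcvg : summable_cvg K) (r0 : 0 < r).
Notation wiener := (wiener c r).

(* Writing D for the quotient by [(z - c) ^+ n], the factor [q] solves
   [q + D (h q) = 1], hence is the sum of the iterates of [- D (h _)] at 1. *)
Lemma weierstrass_preparation n h e : wiener h e ->
  (2 * n.+1)%:R * e < r ^+ n ->
  exists (q : K -> K) (R : {poly K}) M, [/\ (size R <= n)%N,
    forall z, r <= `|z| -> `|R.[z]| < `|z| ^+ n,
    wiener q M, forall z, `|z - c| <= r -> q z != 0 &
    forall z, `|z - c| <= r ->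
      ((z - c) ^+ n + h z) * q z = (z - c) ^+ n + R.[z - c]].
Proof.
move=> he ner; have rn0 : 0 < r ^+ n by rewrite exprn_gt0.
have e0 := wiener_ge0 he.
(* [k] bounds the operator [- D (h _)]. The hypothesis serves two ends: [2 * k < 1] gives the
   iterates of positive index a sum of norm below 1, so that adding 1 cannot produce a zero; and
   [n * (2 * e) < r ^+ n] keeps [R] below [|z| ^+ n] outside the disc. *)
pose k := e / r ^+ n.
have k0 : 0 <= k by rewrite divr_ge0// ltW.
have kn : (2 * n.+1)%:R * k < 1 by rewrite mulrA ltr_pdivrMr// mul1r.
have k2 : 2 * k < 1.
  by rewrite (le_lt_trans _ kn)// ler_wpM2r// ler_nat mulnS leq_addr.
have k1 : k < 1 by rewrite (le_lt_trans _ k2)// mulr_natl mulr2n lerDl.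
have k01 : 0 <= k < 1 by rewrite k0.
have V2 : (1 - k)^-1 <= 2.
  rewrite -[leLHS]mul1r ler_pdivrMr ?subr_gt0// mulrBr mulr1.
  by rewrite lerBrDr -[2]/(1 + 1) lerD// mulrDl !mul1r -mulr2n -mulr_natl ltW.
(* The iteration carries each function together with its norm bound, so that one [choice] gives a
   total step; pairs outside the algebra get a dummy value. *)
have step : forall gM : (K -> K) * K, exists Rg : {poly K} * (K -> K),
    wiener gM.1 gM.2 ->
    [/\ (size Rg.1 <= n)%N, pnorm r Rg.1 <= n%:R * (e * gM.2),
        wiener Rg.2 (k * gM.2) &
        forall z, `|z - c| <= r ->
          h z * gM.1 z = Rg.1.[z - c] - (z - c) ^+ n * Rg.2 z].
  move=> [g M]; have [gM|ngM] := EM (wiener g M); last by exists (0, g).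
  have [R [g' [sR RM g'M hE]]] := wiener_divXn Kcvg r0 n (wienerM r0 he gM).
  exists (R, fun z => - 1 * g' z) => _ /=; split=> //.
    have := wienerZ r0 (- 1) g'M.
    by rewrite normrN normr1 mul1r mulrAC.
  by move=> z zr; rewrite hE// mulN1r mulrN opprK.
have [D DP] := choice step.
pose G := fix G j := if j is j'.+1 then (D (G j', k ^+ j')).2 else fun=> 1.
have GP j : wiener (G j) (k ^+ j).
  elim: j => [|j IH]; first by have := wiener_cst c r0 1; rewrite normr1.
  by rewrite exprS; case: (DP (G j, k ^+ j) IH).
pose Q j := (D (G j, k ^+ j)).1.
have QP j : [/\ (size (Q j) <= n)%N, pnorm r (Q j) <= n%:R * (e * k ^+ j) &
    forall z, `|z - c| <= r ->
      h z * G j z = (Q j).[z - c] - (z - c) ^+ n * G j.+1 z].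
  by case: (DP (G j, k ^+ j) (GP j)).
have QM m : \sum_(j < m) pnorm r (Q j) <= n%:R * (e * 2).
  apply: (@le_trans _ _ (n%:R * (e * \sum_(j < m) k ^+ j))).
    by rewrite !mulr_sumr; apply: ler_sum => j _; case: (QP j).
  by rewrite ler_wpM2l// ler_wpM2l// (le_trans (sum_geometric_le _ k01)).
have sQ j : (size (Q j) <= n)%N by case: (QP j).
have [R [sR RE RM]] := poly_series_cvg Kcvg r0 sQ QM.
have GM m : \sum_(j < m) k ^+ j.+1 <= k * 2.
  under eq_bigr do rewrite exprS.
  by rewrite -mulr_sumr ler_wpM2l// (le_trans (sum_geometric_le _ k01)).
have lim_G : forall z : K, exists l : K, `|z - c| <= r ->
    \sum_(j < m) G j.+1 z @[m --> \oo] --> l.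
  move=> z; have [zr|_] := boolP (`|z - c| <= r); last by exists 0.
  have [|l Gl] := Kcvg (a := fun j => G j.+1 z) (M := k * 2).
    move=> m; rewrite (le_trans _ (GM m))//.
    by apply: ler_sum => j _; exact: wiener_norm_le (GP j.+1) zr.
  by exists l.
have [q qP] := choice lim_G.
have qk : wiener q (k * 2).
  exact: (wiener_series Kcvg r0 (fun j => GP j.+1) GM).
exists (fun z => 1 + q z), R, (`|1| + k * 2); split=> //.
- move=> z rz; rewrite (le_lt_trans (RM z rz))// expr_div_n mulrCA.
  rewrite -[ltRHS]mulr1 ltr_pM2l ?exprn_gt0 ?(lt_le_trans r0)//.
  rewrite ltr_pdivrMr// mul1r (le_lt_trans _ ner)//.
  by rewrite mulrCA mulrC ler_wpM2r// -natrM ler_nat mulnC leq_mul.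
- exact: wienerD (wiener_cst _ r0 1) qk.
- move=> z zr; apply/eqP => /eqP; rewrite addrC addr_eq0 => /eqP qz.
  have := le_lt_trans (wiener_norm_le r0 qk zr) (_ : k * 2 < 1).
  by rewrite qz normrN normr1 ltxx mulrC => /(_ k2).
move=> z zr; pose t := (z - c) ^+ n; rewrite -/t.
have Gm0 : G m z @[m --> \oo] --> (0 : K).
  apply/cvgn_normP => e' e'0.
  have /cvgn_normP/(_ _ e'0)[N HN] := cvgn_expr0 Kcvg k01.
  exists N => m Nm; rewrite (le_trans _ (HN m Nm))// !sub0r !normrN.
  by rewrite (le_trans (wiener_norm_le r0 (GP m) zr))// ger0_norm ?exprn_ge0.
have S1 : \sum_(j < m.+1) G j z @[m --> \oo] --> 1 + q z.
  under eq_fun do rewrite big_ord_recl.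
  by apply: cvgD; [exact: cvg_cst|exact: qP].
have S2 : \sum_(j < m) G j z @[m --> \oo] --> 1 + q z - 0.
  rewrite (_ : (fun m => _) = (fun m => \sum_(j < m.+1) G j z - G m z)).
    exact: cvgB.
  by apply/funext => m; rewrite big_ord_recr /= addrK.
rewrite subr0 in S2.
have S3 : (t + h z) * \sum_(j < m) G j z @[m --> \oo] --> (t + h z) * (1 + q z).
  by apply: cvgM => //; exact: cvg_cst.
apply: (cvgn_uniq S3).
(* Since [h * G j] is [Q j - t * G j.+1], the product telescopes, starting from [G 0 = 1]. *)
rewrite (_ : (fun m => _) =
    (fun m => (t - t * G m z) + \sum_(j < m) (Q j).[z - c])).
  apply: cvgD; last exact: RE.
  rewrite -[X in _ --> X]subr0 -[X in _ --> _ - X](mulr0 t).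
  by apply: cvgB; [exact: cvg_cst|apply: cvgM => //; exact: cvg_cst].
apply/funext; elim=> [|m IH]; first by rewrite !big_ord0 !mulr0 mulr1 subrr addr0.
have [_ _ /(_ z zr)] := QP m; rewrite -/t /= => hG.
by rewrite !big_ord_recr /= mulrDr IH mulrDl hG; ring.
Qed.

End Weierstrass.

Section Hurwitz.
Variables (K : numClosedFieldType) (c r : K).
Hypotheses (Kcvg : summable_cvg K) (r0 : 0 < r).
Notation wiener := (wiener c r).

(** On the disc [f * a * q] is a monic polynomial [W] of degree [n] in [z - c], all of whose roots
    are inside. As [a * q] has no zero there, [f] inherits the roots of [W] with their
    multiplicities. *)
Lemma number_of_zeros_hurwitz n h e (f a : K -> K) : wiener h e ->
  (2 * n.+1)%:R * e < r ^+ n ->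
  (forall z, `|z - c| <= r -> f z * a z = (z - c) ^+ n + h z) ->
  (forall z, `|z - c| < r -> derivable a z 1 /\ a z != 0) ->
  number_of_zeros f [set z : K | `|z - c| < r] n.
Proof.
move=> he ner faE aP.
have [q [R [M [sR Rlt qM q0 fqE]]]] := weierstrass_preparation Kcvg r0 he ner.
pose W := 'X^n + R.
have sW : size W = n.+1 by rewrite size_polyDl size_polyXn.
have lW : lead_coef W = 1 by rewrite lead_coefDl ?size_polyXn ?lead_coefXn.
have [s Ws] := closed_field_poly_normal W; rewrite lW scale1r in Ws.
have WE z : W.[z] = z ^+ n + R.[z] by rewrite !hornerE.
have rootW z : (W.[z] == 0) = (z \in s) by rewrite -rootE Ws root_prod_XsubC.
have s_in z : z \in s -> `|z| < r.
  rewrite -rootW WE addrC addr_eq0 => /eqP Rz.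
  rewrite real_ltNge ?normr_real ?gtr0_real//; apply/negP => rz.
  by have := Rlt _ rz; rewrite Rz normrN normrX ltxx.
have fE z : `|z - c| <= r -> f z * (a z * q z) = W.[z - c].
  by move=> zr; rewrite mulrA faE// fqE// WE.
have aq0 z : `|z - c| < r -> a z * q z != 0.
  by move=> zr; rewrite mulf_neq0 ?q0 ?ltW//; case: (aP z zr).
pose S := [seq z + c | z <- s].
have inS z : (z \in S) = (z - c \in s).
  apply/mapP/idP => [[t ts ->]|zs]; first by rewrite addrK.
  by exists (z - c); rewrite ?subrK.
exists (undup S), (fun z => count_mem z S); split.
- exact: undup_uniq.
- move=> z; rewrite mem_undup inS; split=> [zs|[/= zr fz]].
    have zr : `|z - c| < r by exact: s_in.
    split=> //; apply: (mulIf (aq0 z zr)).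
    by rewrite mul0r fE ?ltW//; apply/eqP; rewrite rootW.
  by rewrite -rootW -fE ?ltW// fz mul0r.
- move=> z; rewrite mem_undup inS => zs; have zr := s_in _ zs.
  (* The factors of [W] with the other roots; [V / (a * q)] is the holomorphic cofactor, nonzero at
     [z]. *)
  pose V := \prod_(t <- s | t != z - c) ('X - t%:P).
  have WV : W = ('X - (z - c)%:P) ^+ count_mem z S * V.
    rewrite Ws (bigID (fun t => t == z - c))/=; congr (_ * _).
    rewrite (eq_bigr (fun=> 'X - (z - c)%:P)); last by move=> t /eqP ->.
    rewrite big_const_seq iter_mulr_1 count_map; congr (_ ^+ _).
    by apply: eq_count => t /=; rewrite [LHS]eq_sym subr_eq eq_sym.
  exists (fun w => V.[w - c] * (a w * q w)^-1); split.
  + near=> w; have wr : `|w - c| < r by near: w; exact: near_normB_lt.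
    apply: (@derivableM K K (fun w => V.[w - c]) (fun w => (a w * q w)^-1)).
      exact: (wiener_derivable Kcvg r0 wr (wiener_poly c r0 V)).
    apply: (@derivableV K K (fun w => a w * q w)); first exact: aq0.
    apply: (@derivableM K K a q); first by case: (aP w wr).
    exact: (wiener_derivable Kcvg r0 wr qM).
  + rewrite mulf_neq0 ?invr_eq0 ?aq0// /V horner_prod prodf_seq_neq0.
    apply/allP => t _; apply/implyP => tz.
    by rewrite hornerXsubC subr_eq0 eq_sym.
  + near=> w; have wr : `|w - c| < r by near: w; exact: near_normB_lt.
    apply: (mulIf (aq0 w wr)); rewrite fE ?ltW// WV hornerM horner_exp.
    by rewrite hornerXsubC opprB addrA subrK -!mulrA mulVf ?aq0// mulr1.
- transitivity (size s); last by apply: succn_inj; rewrite -sW Ws size_prod_XsubC.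
  rewrite -[RHS](size_map (fun z => z + c)) -/S -sum1_size.
  rewrite -(big_undup_iterop_count addn S xpredT (fun=> 1%N)).
  by apply: eq_bigr => z _; rewrite Monoid.iteropE iter_addn_0 mul1n.
Unshelve. all: by end_near. Qed.

(** The point is uniformity: [M] is fixed before [w]. *)
Lemma wiener_bipoly (Q : {poly {poly K}}) : exists M, forall w, wiener w 1 ->
  wiener (fun z => Q.[(w z)%:P].[z]) M.
Proof.
elim/poly_ind: Q => [|Q p [M QM]].
  exists `|0 : K|; move=> w _; apply: wiener_ext (wiener_cst c r0 0) => z _.
  by rewrite horner0 hornerC.
exists (M * 1 + pnorm r (p \Po ('X + c%:P))) => w w1.
have := wienerD r0 (wienerM r0 (QM w w1) w1) (wiener_poly c r0 (p \Po ('X + c%:P))).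
apply: wiener_ext => z _.
by rewrite !hornerE horner_comp !hornerE subrK.
Qed.

(** With [P = p + w * Q] and [p = (z - c) ^+ n * u], where [u] has no root in the closed disc,
    division by [u] leaves [(z - c) ^+ n + w * Q / u], to which Hurwitz's theorem applies. *)
Lemma number_of_zeros_perturb (P : {poly {poly K}}) :
  P`_0 != 0 -> (forall mu : K, root P`_0 mu -> `|mu - c| <= r -> mu = c) ->
  exists2 e : K, 0 < e & forall w f a : K -> K, wiener w e ->
    (forall z : K, `|z - c| <= r -> f z * a z = P.[(w z)%:P].[z]) ->
    (forall z : K, `|z - c| < r -> derivable a z 1 /\ a z != 0) ->
    number_of_zeros f [set z : K | `|z - c| < r] (mup c P`_0).
Proof.
elim/poly_ind: P => [|Q p _]; first by rewrite coef0 eqxx.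
rewrite coefD coefMX coefC /= add0r => p0 rp.
have [n [u]] := multiplicity_XsubC p c; rewrite p0 /= => uc pE.
have -> : mup c p = n by rewrite pE mupMr// mup_XsubCX eqxx.
have u0 : u != 0 by apply: contraNneq uc => ->; rewrite root0.
have ru mu : root u mu -> r < `|mu - c|.
  move=> umu; rewrite real_ltNge ?normr_real ?gtr0_real//.
  apply: contraNN uc => mur; rewrite -(rp mu _ mur)//.
  by rewrite pE rootM umu.
have [N uN] := wiener_inv_poly Kcvg r0 u0 ru.
have [M QM] := wiener_bipoly Q.
have N0 := wiener_ge0 uN.
have M0 : 0 <= M.
  apply: wiener_ge0 (QM (fun=> 1) _).
  by rewrite -[X in wiener _ X]normr1; exact: wiener_cst.
pose k := (2 * n.+1)%:R * (M * N).
have k0 : 0 <= k by rewrite !mulr_ge0.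
have rn0 : 0 < r ^+ n by rewrite exprn_gt0.
have d0 : 0 < r ^+ n + k by rewrite ltr_pwDl.
(* This [e] is at most 1, as the uniform bound on [Q] requires, and [k * e < r ^+ n], as Hurwitz's
   theorem requires. *)
exists (r ^+ n / (r ^+ n + k)); first by rewrite divr_gt0.
set e := r ^+ n / _; move=> w f a we faE aP.
have w1 : wiener w 1.
  by apply: wiener_le we; rewrite ler_pdivrMr// mul1r lerDl.
have hM := wienerM r0 (wienerM r0 (QM w w1) we) uN.
apply: (@number_of_zeros_hurwitz n _ _ f (fun z => a z * u.[z]^-1) hM).
- have -> : (2 * n.+1)%:R * (M * e * N) = r ^+ n * (k / (r ^+ n + k)).
    by rewrite /e /k; ring.
  by rewrite -[ltRHS]mulr1 ltr_pM2l// ltr_pdivrMr// mul1r ltrDr.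
- move=> z zr; have uz : u.[z] != 0.
    by apply/negP => /ru; rewrite real_ltNge ?normr_real ?gtr0_real// zr.
  rewrite mulrA faE// !hornerE {1}pE hornerM horner_exp hornerXsubC mulrDl.
  by rewrite [X in _ + X]mulrAC divff// mul1r addrC.
- move=> z zr; have [da a0] := aP z zr; have uz : u.[z] != 0.
    by apply/negP => /ru; rewrite real_ltNge ?normr_real ?gtr0_real// ltW.
  split; last by rewrite mulf_neq0// invr_eq0.
  apply: (@derivableM K K a (fun z => u.[z]^-1)) => //.
  exact: (wiener_derivable Kcvg r0 zr uN).
Qed.

End Hurwitz.

(** * The complex exponential *)

(* [R[i]] carries the topology of its norm only when seen as a [numFieldType];
   the argument [K] makes unification find that structure. *)
Definition seq_cvg (K : numFieldType) (u : nat -> K) (l : K) : Prop :=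
  u n @[n --> \oo] --> l.

Lemma seq_cvgM (K : numFieldType) (u v : nat -> K) l m :
  seq_cvg u l -> seq_cvg v m -> seq_cvg (fun n => u n * v n) (l * m).
Proof. exact: cvgM. Qed.

Lemma seq_cvgB (K : numFieldType) (u v : nat -> K) l m :
  seq_cvg u l -> seq_cvg v m -> seq_cvg (fun n => u n - v n) (l - m).
Proof. exact: cvgB. Qed.

Section ComplexLimits.
Variable R : realType.
Implicit Types (x y : R) (z w : R[i]).

Lemma cvgn_complex (u v : nat -> R) x y :
  u n @[n --> \oo] --> x -> v n @[n --> \oo] --> y ->
  seq_cvg (fun n => u n +i* v n) (x +i* y).
Proof.
move=> /cvgn_normP ux /cvgn_normP vy; apply/cvgn_normP => e.
rewrite ltcE /= => /andP[/eqP e_im e_re].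
have e2 : 0 < complex.Re e / 2 by rewrite divr_gt0.
have [[N HN] [N' HN']] := (ux _ e2, vy _ e2).
exists (maxn N N') => n; rewrite geq_max => /andP[Nn Nn'].
rewrite (complexE (_ - _)) (le_trans (ler_normD _ _))//= normrM.
have -> : e = (complex.Re e / 2)%:C + (complex.Re e / 2)%:C.
  by rewrite -rmorphD -splitr; case: e e_im {e2 e_re HN HN'} => a b /= ->.
have normi : `|'i%C : R[i]| = 1 by rewrite normc_def /= expr0n expr1n add0r sqrtr1.
rewrite normi mul1r lerD// normc_def /= expr0n addr0 sqrtr_sqr lecR; by auto.
Qed.

Lemma cvg_sum_norm_le (a : nat -> R) (M : R) :
  (forall n, \sum_(i < n) `|a i| <= M) ->
  exists l : R, \sum_(i < n) a i @[n --> \oo] --> l.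
Proof.
move=> aM; have : cvgn (series a).
  apply: normed_cvg; apply: nondecreasing_is_cvgn.
    by apply: nondecreasing_series => i _ _; exact: normr_ge0.
  exists M => _ [n _ <-]; rewrite /= /series /= big_mkord; exact: aM.
move=> /cvg_ex[l al]; exists l.
by move: al; rewrite /series /=; under eq_fun do rewrite big_mkord.
Qed.

Lemma complex_summable_cvg : summable_cvg R[i].
Proof.
move=> a M aM.
have ReM n : \sum_(i < n) `|complex.Re (a i)| <= complex.Re M.
  have : (\sum_(i < n) `|complex.Re (a i)|)%:C <= M.
    rewrite (le_trans _ (aM n))// rmorph_sum; apply: ler_sum => i _.
    exact: normc_ge_Re.
  by rewrite lecE => /andP[].
have ImM n : \sum_(i < n) `|complex.Im (a i)| <= complex.Re M.
  have : (\sum_(i < n) `|complex.Im (a i)|)%:C <= M.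
    rewrite (le_trans _ (aM n))// rmorph_sum; apply: ler_sum => i _.
    rewrite -normrN -ReiNIm (le_trans (normc_ge_Re _))// normrM.
    by rewrite [X in _ * X]normc_def /= expr0n expr1n add0r sqrtr1 mulr1.
  by rewrite lecE => /andP[].
have [x ax] := @cvg_sum_norm_le (fun i => complex.Re (a i)) _ ReM.
have [y ay] := @cvg_sum_norm_le (fun i => complex.Im (a i)) _ ImM.
exists (x +i* y); rewrite (_ : (fun n => _) = (fun n =>
  (\sum_(i < n) complex.Re (a i)) +i* (\sum_(i < n) complex.Im (a i)))).
  exact: cvgn_complex.
apply/funext; elim=> [|n IH]; first by rewrite !big_ord0.
by rewrite !big_ord_recr /= IH; case: (a n).
Qed.

End ComplexLimits.

Section ExpPartialSum.
Variable K : numFieldType.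
Implicit Types x y : K.

Definition exp_psum n x : K := \sum_(i < n) x ^+ i / i`!%:R.

(* The terms of the product of two partial sums of the exponential series that
   do not occur in the partial sum at [x + y]. *)
Definition exp_defect n x y : K :=
  \sum_(0 <= i < n) \sum_(n - i <= j < n) (x ^+ i / i`!%:R) * (y ^+ j / j`!%:R).

Lemma exp_psumD n x y :
  exp_psum n x * exp_psum n y = exp_psum n (x + y) + exp_defect n x y.
Proof.
pose g i j := (x ^+ i / i`!%:R) * (y ^+ j / j`!%:R).
have fact_neq0 k : k`!%:R != 0 :> K by rewrite pnatr_eq0 -lt0n fact_gt0.
have -> : exp_psum n (x + y) = \sum_(i < n) \sum_(0 <= j < n - i) g i j.
  elim: n => [|n IH]; first by rewrite /exp_psum !big_ord0.
  rewrite /exp_psum big_ord_recr /= -/(exp_psum n (x + y)) IH.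
  have -> : \sum_(i < n.+1) \sum_(0 <= j < n.+1 - i) g i j =
      \sum_(i < n.+1) (\sum_(0 <= j < n - i) g i j + g i (n - i)%N).
    by apply: eq_bigr => i _; rewrite subSn ?big_nat_recr//= -ltnS.
  rewrite big_split /= big_ord_recr /= subnn big_geq// addr0; congr (_ + _).
  rewrite addrC exprDn mulr_suml; apply: eq_bigr => i _.
  have in' : (i <= n)%N by rewrite -ltnS.
  rewrite /g -(bin_fact in') -mulr_natr !natrM.
  have c0 : 'C(n, i)%:R != 0 :> K by rewrite pnatr_eq0 -lt0n bin_gt0.
  by field; rewrite c0 !fact_neq0.
rewrite /exp_defect big_mkord -big_split /= /exp_psum mulr_suml.
apply: eq_bigr => i _.
rewrite mulr_sumr -(big_mkord xpredT (fun j => g i j)).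
by rewrite (big_cat_nat (leq0n (n - i)) (leq_subr i n)).
Qed.

(** The coefficients of the defect are nonnegative, which reduces the complex case to the real
    one. *)
Lemma norm_exp_defect n x y : `|exp_defect n x y| <= exp_defect n `|x| `|y|.
Proof.
rewrite (le_trans (ler_norm_sum _ _ _))//; apply: ler_sum => i _.
rewrite (le_trans (ler_norm_sum _ _ _))//; apply: ler_sum => j _.
by rewrite !(normrM, normrX, normfV, normr_nat).
Qed.

End ExpPartialSum.

Section ComplexExp.
Variable R : realType.
Implicit Types (x y : R) (z w : R[i]).

Lemma exp_psum_real n x : exp_psum n x%:C = (exp_psum n x)%:C.
Proof.
rewrite rmorph_sum; apply: eq_bigr => i _.
by rewrite rmorphM rmorphXn fmorphV rmorph_nat.
Qed.

Lemma exp_psum_cvg x : exp_psum n x @[n --> \oo] --> expR x.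
Proof.
rewrite (_ : (fun n => _) = series (exp_coeff x)).
  exact: is_cvg_series_exp_coeff.
by apply/funext => n; rewrite /series /= big_mkord.
Qed.

Lemma exp_psum_le n x : 0 <= x -> exp_psum n x <= expR x.
Proof.
move=> x0; have cx := is_cvg_series_exp_coeff x.
have := nondecreasing_cvgn_le _ cx n.
rewrite /series /= big_mkord; apply; apply: nondecreasing_series => i _ _.
exact: exp_coeff_ge0.
Qed.

Lemma exp_psum_imag n y : exp_psum n (0 +i* y) =
  (\sum_(i < n) cos_coeff y i) +i* (\sum_(i < n) sin_coeff y i).
Proof.
elim: n => [|n IH]; first by rewrite /exp_psum !big_ord0.
rewrite /exp_psum !big_ord_recr /= -/(exp_psum n _) IH.
(* The exponents follow [cos_coeff] and [sin_coeff]; for odd [n] the two halves agree. *)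
have iy : (0 +i* y) ^+ n = (~~ odd n)%:R * (-1) ^+ n./2 * y ^+ n +i*
    ((odd n)%:R * (-1) ^+ n.-1./2 * y ^+ n) :> R[i].
  rewrite (_ : 0 +i* y = 'i%C * y%:C); last by simpc.
  rewrite exprMn -rmorphXn -{1}(odd_double_half n) exprD -mul2n exprM sqr_i.
  have -> : (odd n)%:R * (-1) ^+ n.-1./2 = (odd n)%:R * (-1) ^+ n./2 :> R.
    case: n {IH} => [|n] /=; first by rewrite !mul0r.
    by rewrite uphalf_half; case: (odd n); rewrite ?mul0r ?add0n.
  have -> : (-1) ^+ n./2 = ((-1) ^+ n./2)%:C :> R[i].
    by rewrite rmorphXn rmorphN1.
  by case: (odd n); rewrite ?expr0 ?expr1 !(mul1r, mul0r); simpc.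
rewrite iy /cos_coeff /sin_coeff.
rewrite -(rmorph_nat (real_complex R)) -fmorphV /=; simpc.
done.
Qed.

Lemma cexpD z w : cexp (z + w) = cexp z * cexp w.
Proof.
case: z w => [a b] [c d]; rewrite /cexp /= expRD cosD sinD; simpc.
by congr (_ +i* _); ring.
Qed.

Lemma exp_defect_cvg0 x y : exp_defect n x y @[n --> \oo] --> (0 : R).
Proof.
rewrite -(subrr (expR (x + y))) [X in X - _]expRD.
rewrite (_ : (fun n => _) =
    (fun n => exp_psum n x * exp_psum n y - exp_psum n (x + y))).
  apply: cvgB; last exact: exp_psum_cvg.
  by apply: cvgM; exact: exp_psum_cvg.
by apply/funext => n; rewrite exp_psumD addrAC subrr add0r.
Qed.

Lemma cos_psum_cvg y : \sum_(i < n) cos_coeff y i @[n --> \oo] --> cos y.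
Proof.
rewrite (_ : (fun n => _) = series (cos_coeff y)).
  by rewrite unlock; exact: is_cvg_series_cos_coeff.
by apply/funext => n; rewrite /series /= big_mkord.
Qed.

Lemma sin_psum_cvg y : \sum_(i < n) sin_coeff y i @[n --> \oo] --> sin y.
Proof.
rewrite (_ : (fun n => _) = series (sin_coeff y)).
  by rewrite unlock; exact: is_cvg_series_sin_coeff.
by apply/funext => n; rewrite /series /= big_mkord.
Qed.

Lemma exp_defect_real n x y :
  exp_defect n x%:C y%:C = (exp_defect n x y)%:C.
Proof.
apply: (addrI (exp_psum n (x%:C + y%:C))).
by rewrite -exp_psumD -rmorphD !exp_psum_real -rmorphM -rmorphD exp_psumD.
Qed.

(** [cexp] is given by its real and imaginary parts, while the algebra needs a power series. The
    real series at [Re z] and the cosine and sine series at [Im z] are multiplied, and the defect of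
    the product tends to 0. *)
Lemma cexp_cvg z : seq_cvg (fun n => exp_psum n z) (cexp z).
Proof.
case: z => x y; pose xc : R[i] := x%:C; pose iy : R[i] := 0 +i* y.
have xy : x +i* y = xc + iy by rewrite /xc /iy; simpc.
have x_cvg : seq_cvg (fun n => exp_psum n xc) (expR x)%:C.
  rewrite (_ : (fun n => _) = (fun n => (exp_psum n x)%:C)).
    by apply: cvgn_complex; [exact: exp_psum_cvg|exact: cvg_cst].
  by apply/funext => n; rewrite exp_psum_real.
have y_cvg : seq_cvg (fun n => exp_psum n iy) (cos y +i* sin y).
  rewrite (_ : (fun n => _) = (fun n => (\sum_(i < n) cos_coeff y i) +i*
      (\sum_(i < n) sin_coeff y i))).
    by apply: cvgn_complex; [exact: cos_psum_cvg|exact: sin_psum_cvg].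
  by apply/funext => n; rewrite exp_psum_imag.
have d_cvg : seq_cvg (fun n => exp_defect n xc iy) 0.
  have d0 : seq_cvg (fun n => (exp_defect n `|x| `|y|)%:C) (0 : R)%:C.
    by apply: cvgn_complex; [exact: exp_defect_cvg0|exact: cvg_cst].
  apply/cvgn_normP => e e0; have /cvgn_normP/(_ e e0)[N HN] := d0.
  exists N => n Nn; rewrite (le_trans _ (HN n Nn))// !sub0r !normrN.
  rewrite (le_trans (norm_exp_defect _ _ _))// !normc_def /= !expr0n /= addr0 add0r.
  rewrite !sqrtr_sqr exp_defect_real.
  by rewrite lecR addr0 sqrtr_sqr ler_norm.
have -> : cexp (x +i* y) = (expR x)%:C * (cos y +i* sin y) - 0.
  by rewrite subr0 /cexp; simpc.
rewrite (_ : (fun n => _) =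
    (fun n => exp_psum n xc * exp_psum n iy - exp_defect n xc iy)).
  by apply: seq_cvgB d_cvg; exact: seq_cvgM.
by apply/funext => n; rewrite exp_psumD addrK xy.
Qed.

Lemma norm_cexp z : `|cexp z| = (expR (complex.Re z))%:C.
Proof.
case: z => x y; rewrite /cexp normc_def /=.
by rewrite !exprMn -mulrDr cos2Dsin2 mulr1 sqrtr_sqr ger0_norm// expR_ge0.
Qed.

Lemma cexp_neq0 z : cexp z != 0.
Proof. by rewrite -normr_eq0 norm_cexp (inj_eq (@complexI R)) expR_eq0. Qed.

Lemma cexp0 : cexp 0 = 1 :> R[i].
Proof. by rewrite /cexp /= expR0 cos0 sin0 !mul1r. Qed.

Lemma cexpN z : cexp (- z) = (cexp z)^-1.
Proof.
by apply: (mulfI (cexp_neq0 z)); rewrite -cexpD subrr cexp0 divff// cexp_neq0.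
Qed.

(* [expR (a * Re c + |a| * r)] is the maximum of [|cexp (a * z)|] on the
   disc. *)
Lemma wiener_cexp (c : R[i]) (a r : R) : 0 < r ->
  @wiener R[i] c r%:C (fun z => cexp (a%:C * z))
    (expR (a * complex.Re c + `|a| * r))%:C.
Proof.
move=> r0; have r0' : 0 < r%:C by rewrite ltcR.
have H : @wiener R[i] c r%:C (fun z => cexp (a%:C * (z - c))) (expR (`|a| * r))%:C.
  exists (fun i => (a%:C ^+ i / i`!%:R) *: 'X^i); split=> [n|z _].
    under eq_bigr do rewrite pnormZ pnormXn.
    rewrite (_ : \sum_(i < n) _ = (exp_psum n (`|a| * r))%:C).
      by rewrite lecR exp_psum_le// mulr_ge0// ltW.
    rewrite -exp_psum_real; apply: eq_bigr => i _.
    rewrite normrM normrX normfV normr_nat normc_def /= expr0n addr0 sqrtr_sqr.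
    by rewrite rmorphM exprMn mulrAC.
  rewrite (_ : (fun n => _) = (fun n => exp_psum n (a%:C * (z - c)))).
    exact: cexp_cvg.
  apply/funext => n; apply: eq_bigr => i _.
  by rewrite hornerZ hornerXn exprMn mulrAC.
rewrite expRD rmorphM /=.
have -> : (expR (a * complex.Re c))%:C = `|cexp (a%:C * c)|.
  by rewrite norm_cexp; case: c {H} => x y; simpc.
apply: wiener_ext (wienerZ r0' _ H) => z _.
by rewrite -cexpD; congr cexp; ring.
Qed.

End ComplexExp.

(** * The characteristic function as a polynomial in two variables *)

Section BivariateDet.
Variable C : comNzRingType.
Implicit Types (w z : C).

(** The outer variable is the small parameter, so that the outer constant coefficient is the limit
    polynomial in [z]. *)
Definition eval2 w z (p : {poly {poly C}}) : C := p.[w%:P].[z].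

Definition mx2 m n (M : 'M[C]_(m, n)) : 'M[{poly {poly C}}]_(m, n) :=
  map_mx (fun x => x%:P%:P) M.

Lemma eval2_det n (M : 'M[{poly {poly C}}]_n) w z :
  eval2 w z (\det M) = \det (map_mx (eval2 w z) M).
Proof.
rewrite /eval2 -[_.[w%:P]]/(horner_eval w%:P _) -det_map_mx.
rewrite -[(\det _).[z]]/(horner_eval z _) -det_map_mx; congr (\det _).
by apply/matrixP => i j; rewrite !mxE.
Qed.

Lemma det_coef0 n (M : 'M[{poly {poly C}}]_n) :
  (\det M)`_0 = \det (map_mx (fun p : {poly {poly C}} => p`_0) M).
Proof.
rewrite -horner_coef0 -[_.[0]]/(horner_eval 0 _) -det_map_mx.
by congr (\det _); apply/matrixP => i j; rewrite !mxE -horner_coef0.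
Qed.

Lemma eval2_mx m n (M : 'M[C]_(m, n)) w z : map_mx (eval2 w z) (mx2 M) = M.
Proof. by apply/matrixP => i j; rewrite !mxE /eval2 !hornerC. Qed.

Lemma eval2D w z : {morph eval2 w z : p q / p + q}.
Proof. by move=> p q; rewrite /eval2 !hornerD. Qed.

Lemma eval2N w z : {morph eval2 w z : p / - p}.
Proof. by move=> p; rewrite /eval2 !hornerN. Qed.

Lemma eval2M w z : {morph eval2 w z : p q / p * q}.
Proof. by move=> p q; rewrite /eval2 !hornerM. Qed.

Lemma eval2_outer w z : eval2 w z 'X = w.
Proof. by rewrite /eval2 hornerX hornerC. Qed.

Lemma eval2_char n (A : 'M[C]_n) w z :
  map_mx (eval2 w z) ('X%:P%:M - mx2 A) = z%:M - A.
Proof.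
apply/matrixP => i j; rewrite !mxE eval2D eval2N /eval2 !hornerC.
by case: (i == j); rewrite ?mulr1n ?mulr0n ?hornerC ?hornerX ?horner0.
Qed.

Lemma coef0_char n (A : 'M[C]_n) :
  map_mx (fun p : {poly {poly C}} => p`_0) ('X%:P%:M - mx2 A) = char_poly_mx A.
Proof.
apply/matrixP => i j; rewrite !mxE coefB coefC /=; congr (_ - _).
by case: (i == j); rewrite ?mulr1n ?mulr0n ?coefC ?coef0.
Qed.

End BivariateDet.

Section Pencils.
Variable C : comNzRingType.

Definition pencil_plus n (A B : 'M[C]_n) : {poly {poly C}} :=
  \det ('X%:P%:M - mx2 A - 'X *: mx2 B).

Lemma pencil_plusE n (A B : 'M[C]_n) w z :
  eval2 w z (pencil_plus A B) = \det (z%:M - A - w *: B).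
Proof.
rewrite /pencil_plus eval2_det; congr (\det _).
rewrite -[in RHS](eval2_char A w z) -[in RHS](eval2_mx B w z).
by apply/matrixP => i j; rewrite !mxE eval2D eval2N eval2M eval2_outer.
Qed.

Lemma pencil_plus_coef0 n (A B : 'M[C]_n) : (pencil_plus A B)`_0 = char_poly A.
Proof.
rewrite /pencil_plus det_coef0; congr (\det _); rewrite -coef0_char.
by apply/matrixP => i j; rewrite !mxE coefB coefXM subr0.
Qed.

(* For [v * w = 1], this is the determinant of [z - A - w B] with its last [d]
   rows multiplied by [v]. *)
Definition pencil_minus m d (A1 : 'M[C]_m) (A2 : 'M[C]_(m, d))
    (A3 : 'M[C]_(d, m)) (A4 Bbar : 'M[C]_d) : {poly {poly C}} :=
  \det (block_mx ('X%:P%:M - mx2 A1) (- mx2 A2)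
    (- ('X *: mx2 A3)) ('X *: ('X%:P%:M - mx2 A4) - mx2 Bbar)).

Lemma pencil_minusE m d (A1 : 'M[C]_m) (A2 : 'M[C]_(m, d))
    (A3 : 'M[C]_(d, m)) (A4 Bbar : 'M[C]_d) v w z : v * w = 1 ->
  eval2 v z (pencil_minus A1 A2 A3 A4 Bbar) =
  v ^+ d * \det (z%:M - block_mx A1 A2 A3 A4 - w *: block_mx 0 0 0 Bbar).
Proof.
move=> vw; rewrite /pencil_minus eval2_det map_block_mx.
rewrite eval2_char.
have -> : v ^+ d = \det (block_mx (1%:M : 'M[C]_m) 0 0 (v%:M : 'M[C]_d)).
  by rewrite det_ublock det1 det_scalar mul1r.
rewrite -det_mulmx scalar_mx_block scale_block_mx !scaler0.
rewrite !opp_block_mx !add_block_mx.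
rewrite mulmx_block !mul1mx !mul0mx !addr0 !add0r !oppr0 !addr0 !mul_scalar_mx.
congr (\det (block_mx _ _ _ _)).
- by rewrite -[in RHS](eval2_mx A2 v z); apply/matrixP => i j; rewrite !mxE eval2N.
- rewrite -[in RHS](eval2_mx A3 v z); apply/matrixP => i j.
  by rewrite !mxE eval2N eval2M eval2_outer mulrN.
rewrite [in RHS]scalerBr scalerA vw scale1r -(eval2_char A4 v z).
rewrite -[in RHS](eval2_mx Bbar v z).
by apply/matrixP => i j; rewrite !mxE eval2D eval2M eval2N eval2_outer.
Qed.

(** At parameter 0 the lower left block vanishes and the matrix is block triangular. *)
Lemma pencil_minus_coef0 m d (A1 : 'M[C]_m) (A2 : 'M[C]_(m, d))
    (A3 : 'M[C]_(d, m)) (A4 Bbar : 'M[C]_d) :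
  (pencil_minus A1 A2 A3 A4 Bbar)`_0 = char_poly A1 * (\det (- Bbar))%:P.
Proof.
rewrite /pencil_minus det_coef0 map_block_mx coef0_char.
have -> : map_mx (fun p : {poly {poly C}} => p`_0) (- ('X *: mx2 A3)) = 0.
  by apply/matrixP => i j; rewrite !mxE coefN coefXM oppr0.
rewrite det_ublock -det_map_mx; congr (_ * \det _).
by apply/matrixP => i j; rewrite !mxE coefB coefXM coefC sub0r rmorphN.
Qed.

End Pencils.

(** * Discs away from the imaginary axis, and exponential decay in [1/eps] *)

Section Disc.
Variable R : realType.
Implicit Types (z w : R[i]) (S : set R[i]).

Lemma normCE z : `|z| = (ComplexField.Normc.normc z)%:C.
Proof. by []. Qed.

Lemma Re_norm_le z : `|complex.Re z| <= ComplexField.Normc.normc z.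
Proof. by rewrite -lecR -normCE normc_ge_Re. Qed.

Lemma cdiscE z (delta : R) :
  cdisc z delta = [set w : R[i] | `|w - z| < delta%:C].
Proof. by apply/seteqP; split=> w; rewrite /cdisc /= normCE ltcR. Qed.

Lemma disc_radius_Re S z (delta : R) : S z ->
  (delta%:E <= disc_radius S)%E -> 3 * delta <= `|complex.Re z|.
Proof.
move=> Sz H.
have : (delta%:E <= (3^-1)%:E * (`|complex.Re z|)%:E)%E.
  apply: (le_trans H); rewrite lee_pmul2l ?lte_fin ?invr_gt0//.
  rewrite ge_min; apply/orP; right; apply: ereal_inf_lbound.
  (* The orthogonal projection of [z] to the imaginary axis. *)
  exists (z, 0 +i* complex.Im z) => //=.
  by case: z {H Sz} => x y; rewrite /= subrr expr0n /= !addr0 subr0 sqrtr_sqr.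
by rewrite -EFinM lee_fin mulrC ler_pdivlMr// mulrC.
Qed.

Lemma disc_radius_sep S z w (delta : R) : S z -> S w -> z != w ->
  (delta%:E <= disc_radius S)%E -> 3 * delta <= ComplexField.Normc.normc (z - w).
Proof.
move=> Sz Sw zw H.
have : (delta%:E <= (3^-1)%:E * (ComplexField.Normc.normc (z - w))%:E)%E.
  apply: (le_trans H); rewrite lee_pmul2l ?lte_fin ?invr_gt0//.
  by rewrite ge_min; apply/orP; left; apply: ereal_inf_lbound; exists (z, w).
by rewrite -EFinM lee_fin mulrC ler_pdivlMr// mulrC.
Qed.

Lemma Re_disc z w (delta : R) : `|w - z| <= delta%:C ->
  `|complex.Re w - complex.Re z| <= delta.
Proof.
rewrite normCE lecR; apply: le_trans; apply: le_trans (Re_norm_le _).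
by case: z w => [a b] [c d].
Qed.

Lemma expR_small (x : R) (M e : R[i]) : 0 < x -> 0 <= M -> 0 < e ->
  exists2 e0 : R, 0 < e0 & forall eps, 0 < eps -> eps < e0 ->
    (expR (- (x / eps)))%:C * M <= e.
Proof.
move=> x0; case: M => M1 M2; case: e => e1 e2.
rewrite lecE ltcE /= => /andP[/eqP -> M0] /andP[/eqP -> e0].
have M1_gt0 : 0 < M1 + 1 by rewrite ltr_wpDl.
(* From [expR (- t) <= 1 / t] with [t = x / eps]; the [+ 1] keeps the denominator positive. *)
exists (x * e1 / (M1 + 1)); first by rewrite divr_gt0// mulr_gt0.
move=> eps eps0; rewrite ltr_pdivlMr// => epsM.
have -> : (expR (- (x / eps)))%:C * (M1 +i* 0) = (expR (- (x / eps)) * M1)%:C.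
  by simpc.
rewrite -[e1 +i* 0]/(e1%:C) lecR.
have xe : x / eps <= expR (x / eps).
  by rewrite (le_trans _ (expR_ge1Dx _))// lerDr.
have xe0 : 0 < x / eps by rewrite divr_gt0.
rewrite expRN mulrC ler_pdivrMr ?expR_gt0//.
apply: (@le_trans _ _ (e1 * (x / eps))); last by rewrite ler_wpM2l// ltW.
rewrite mulrA ler_pdivlMr// mulrC [e1 * x]mulrC (le_trans _ (ltW epsM))//.
by rewrite ler_wpM2l ?lerDl// ltW.
Qed.

End Disc.

(** * Counting zeros in a disc of either half plane *)

Section Counting.
Variables (R : realType) (rho delta : R) (c : R[i]).
Hypotheses (rho0 : 0 < rho) (delta0 : 0 < delta).
Hypothesis cdelta : 3 * delta <= `|complex.Re c|.

Let r : R[i] := delta%:C.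
Let r0 : 0 < r. Proof. by rewrite ltcR. Qed.
Let Kcvg : summable_cvg R[i] := @complex_summable_cvg R.
Let delta_lt : delta < `|complex.Re c|.
Proof. by rewrite (lt_le_trans _ cdelta)// ltr_pMl// ltr1n. Qed.
Notation wiener := (@wiener R[i] c r).

Lemma disc_neq0 (z : R[i]) : `|z - c| <= r -> z != 0.
Proof.
move=> /Re_disc; apply: contraTneq => -> /=.
by rewrite sub0r normrN -ltNge.
Qed.

(** The closed disc avoids 0, so [1 / z] belongs to the algebra and the removable singularity is
    never met. *)
Lemma wiener_csinhc : exists M, wiener (fun z => csinhc (z * rho%:C)) M.
Proof.
have rc : r < `|0 - c|.
  rewrite sub0r normrN normCE ltcR (lt_le_trans delta_lt)//; exact: Re_norm_le.
have [N zN] := wiener_invXsubC Kcvg r0 rc.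
have sM := wienerM r0 (wienerZ r0 (2 * rho%:C)^-1 (wienerD r0
  (wiener_cexp c rho delta0) (wienerZ r0 (-1) (wiener_cexp c (- rho) delta0)))) zN.
eexists; apply: wiener_ext sM => z /disc_neq0 z0 /=.
have rhoC0 : rho%:C != 0 by rewrite gt_eqF// ltcR.
rewrite /csinhc mulf_eq0 (negPf z0) (negPf rhoC0) /= /csinh subr0.
have -> : (- rho)%:C * z = - (z * rho%:C) by rewrite rmorphN /=; ring.
rewrite [rho%:C * z]mulrC.
by field; rewrite z0 rhoC0.
Qed.

Lemma number_of_zeros_plus n (A B : 'M[R]_n) : 0 < complex.Re c ->
  (forall mu, root (char_poly (cmx A)) mu -> `|mu - c| <= r -> mu = c) ->
  exists2 e0 : R, 0 < e0 & forall eps, 0 < eps -> eps < e0 ->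
    number_of_zeros (Delta A B rho eps) (cdisc c delta) (alg_mult A c).
Proof.
move=> c0 rootA; have [M sM] := wiener_csinhc.
have := @number_of_zeros_perturb _ c r Kcvg r0 (pencil_plus (cmx A) (cmx B)).
rewrite pencil_plus_coef0 => /(_ (monic_neq0 (char_poly_monic _)) rootA)[e e_gt0 He].
(* The least real part on the closed disc, hence the decay rate of [w] in [1/eps]. *)
have x0 : 0 < complex.Re c - delta by rewrite subr_gt0 -(gtr0_norm c0).
have [e0 e0_gt0 small] := expR_small x0 (wiener_ge0 sM) e_gt0.
exists e0 => // eps eps0 epse0; rewrite cdiscE.
apply: (He (fun z => cexp (- z / eps%:C) * csinhc (z * rho%:C)) _ (fun=> 1)).
- apply: wiener_le (small _ eps0 epse0) _.
  have := wienerM r0 (wiener_cexp c (- eps^-1) delta0) sM.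
  have -> : - eps^-1 * complex.Re c + `|- eps^-1| * delta =
      - ((complex.Re c - delta) / eps).
    by rewrite normrN gtr0_norm ?invr_gt0//; ring.
  apply: wiener_ext => z _; congr (cexp _ * _).
  by rewrite rmorphN fmorphV mulNr mulrC mulNr.
- by move=> z _; rewrite mulr1 -[RHS]/(eval2 _ _ _) pencil_plusE.
- by move=> z _; split; [exact: derivable_cst|exact: oner_neq0].
Qed.

(** The inverse is [- 2 rho z e^(rho z) / (1 - e^(2 rho z))]. On a disc in the left half plane
    [e^(2 rho z)] has norm below 1 in the algebra, so the Neumann series inverts the denominator. *)
Lemma wiener_csinhcV : complex.Re c < 0 ->
  (exists M, wiener (fun z => (csinhc (z * rho%:C))^-1) M) /\
  forall z, `|z - c| <= r -> csinhc (z * rho%:C) != 0.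
Proof.
move=> c0.
have Re_lt0 (z : R[i]) : `|z - c| <= r -> complex.Re z < 0.
  move=> /Re_disc; rewrite ler_distl => /andP[_ zc].
  by rewrite (le_lt_trans zc)// -ltrBrDl sub0r -(ltr0_norm c0).
have rhoC0 : rho%:C != 0 by rewrite gt_eqF// ltcR.
have E1 (z : R[i]) : `|z - c| <= r -> 1 - cexp ((2 * rho)%:C * z) != 0.
  move=> /Re_lt0 z0; rewrite subr_eq0 eq_sym.
  apply/eqP => /(congr1 (fun w => `|w|)); rewrite norm_cexp normr1.
  case: z z0 => a b /= a0; simpc; case=> /eqP.
  by rewrite lt_eqF// expR_lt1 pmulr_rlt0 ?mulr_gt0.
have sE (z : R[i]) : `|z - c| <= r -> (csinhc (z * rho%:C))^-1 =
    - (2 * rho%:C) * z * cexp (rho%:C * z) * (1 - cexp ((2 * rho)%:C * z))^-1.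
  move=> zr; have z0 := disc_neq0 zr; have := E1 z zr.
  have -> : cexp ((2 * rho)%:C * z) = cexp (rho%:C * z) * cexp (rho%:C * z).
    by rewrite -cexpD; congr cexp; rewrite rmorphM rmorph_nat; ring.
  rewrite /csinhc mulf_eq0 (negPf z0) (negPf rhoC0) /= /csinh cexpN.
  rewrite [z * _]mulrC; have := cexp_neq0 (rho%:C * z).
  move: (cexp _) => E E0 E2.
  have E3 : E - E^-1 != 0.
    apply: contraNneq E2 => /eqP; rewrite subr_eq0 => /eqP {1}->.
    by rewrite mulVf// subrr.
  have E4 : E * E - 1 != 0 by rewrite -opprB oppr_eq0.
  by field; rewrite E0 z0 rhoC0 E2 E4.
split; last first.
  move=> z zr; rewrite -invr_eq0 sE// !mulf_eq0 oppr_eq0 mulf_eq0 invr_eq0.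
  rewrite pnatr_eq0 (negPf rhoC0) (negPf (disc_neq0 zr)) (negPf (cexp_neq0 _)).
  exact: E1.
have k1 : (expR (2 * rho * complex.Re c + `|2 * rho| * delta))%:C < 1.
  rewrite ltcR expR_lt1 gtr0_norm ?mulr_gt0// -mulrDr pmulr_rlt0 ?mulr_gt0//.
  by rewrite -ltrBrDl sub0r -(ltr0_norm c0).
have iM := wiener_inv1B Kcvg r0 (wiener_cexp c (2 * rho) delta0) k1.
have zM := wiener_poly c r0 ('X + c%:P).
have sM := wienerM r0 (wienerM r0 (wienerZ r0 (- (2 * rho%:C)) zM)
  (wiener_cexp c rho delta0)) iM.
eexists; apply: wiener_ext sM => z zr; rewrite sE//.
by rewrite !hornerE subrK.
Qed.

Lemma number_of_zeros_minus m d (A1 : 'M[R]_m) (A2 : 'M[R]_(m, d))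
    (A3 : 'M[R]_(d, m)) (A4 Bbar : 'M[R]_d) : complex.Re c < 0 ->
  Bbar \in unitmx ->
  (forall mu, root (char_poly (cmx A1)) mu -> `|mu - c| <= r -> mu = c) ->
  exists2 e0 : R, 0 < e0 & forall eps, 0 < eps -> eps < e0 ->
    number_of_zeros (Delta (block_mx A1 A2 A3 A4) (block_mx 0 0 0 Bbar) rho eps)
      (cdisc c delta) (alg_mult A1 c).
Proof.
move=> c0 uB rootA; have [[M sM] s_neq0] := wiener_csinhcV c0.
(* The limit polynomial is [char_poly A1] times this constant, so invertibility of [Bbar] preserves
   its roots and multiplicities. *)
have detB : \det (- cmx Bbar) != 0.
  rewrite -scaleN1r detZ mulf_neq0 ?expf_neq0 ?oppr_eq0 ?oner_neq0//.
  by rewrite det_map_mx fmorph_eq0 -unitfE -unitmxE.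
have := @number_of_zeros_perturb _ c r Kcvg r0
  (pencil_minus (cmx A1) (cmx A2) (cmx A3) (cmx A4) (cmx Bbar)).
rewrite pencil_minus_coef0 mupMl ?rootC//.
case=> [|mu|e e_gt0 He].
- by rewrite mulf_neq0 ?polyC_eq0// monic_neq0// char_poly_monic.
- by rewrite rootM rootC (negPf detB) orbF; exact: rootA.
have x0 : 0 < - complex.Re c - delta by rewrite subr_gt0 -(ltr0_norm c0).
have [e0 e0_gt0 small] := expR_small x0 (wiener_ge0 sM) e_gt0.
exists e0 => // eps eps0 epse0; rewrite cdiscE.
pose v z := cexp ((eps^-1)%:C * z) * (csinhc (z * rho%:C))^-1.
have vM := wienerM r0 (wiener_cexp c eps^-1 delta0) sM.
have v0 z : `|z - c| <= r -> v z != 0.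
  by move=> zr; rewrite mulf_neq0 ?cexp_neq0// invr_eq0 s_neq0.
(* Here the auxiliary factor [a] is the determinant of the row scaling. *)
apply: (He v _ (fun z => v z ^+ d)).
- apply: wiener_le (small _ eps0 epse0) _.
  rewrite (_ : - _ = eps^-1 * complex.Re c + `|eps^-1| * delta)//.
  by rewrite gtr0_norm ?invr_gt0//; ring.
- move=> z zr; rewrite -[RHS]/(eval2 _ _ _).
  have vw : v z * (cexp (- z / eps%:C) * csinhc (z * rho%:C)) = 1.
    rewrite /v mulNr [z / _]mulrC cexpN -fmorphV mulrACA divff ?cexp_neq0//.
    by rewrite mulVf ?mulr1// s_neq0.
  rewrite (pencil_minusE _ _ _ _ _ _ vw) mulrC /Delta /cmx !map_block_mx.
  by rewrite !map_mx0.
- move=> z zr; split; last by rewrite expf_neq0// v0// ltW.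
  exact: (wiener_derivable Kcvg r0 zr (wienerX r0 d vM)).
Qed.

End Counting.

Lemma disc_radius_unique (R : realType) (S : set R[i]) (z w : R[i]) (delta : R) :
  0 < delta -> S z -> S w -> (delta%:E <= disc_radius S)%E ->
  `|w - z| <= delta%:C -> w = z.
Proof.
move=> d0 Sz Sw H; rewrite distrC normCE lecR => wz; apply/esym/eqP.
apply/negPn/negP => zw.
have := le_trans (disc_radius_sep Sz Sw zw H) wz.
by rewrite leNgt ltr_pMl// ltr1n.
Qed.

Lemma spectrum_root (R : realType) n (M : 'M[R]_n) (z : R[i]) :
  spectrum M z = root (char_poly (cmx M)) z.
Proof. by rewrite /spectrum /= eigenvalue_root_char. Qed.

Unset Implicit Arguments.

Theorem theoremA1 (R : realType) (m d : nat) (rho : R)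
    (A1 : 'M[R]_m) (A2 : 'M[R]_(m, d)) (A3 : 'M[R]_(d, m)) (A4 : 'M[R]_d)
    (Bbar : 'M[R]_d) (A B : 'M[R]_(m + d))
    (hd : (1 <= d)%N) (hrho : 0 < rho) (hBbar : Bbar \in unitmx)
    (hA : A = block_mx A1 A2 A3 A4) (hB : B = block_mx 0 0 0 Bbar) :
  (forall lambda : R[i], spec_plus A lambda ->
     forall delta : R, 0 < delta ->
       (delta%:E <= disc_radius (spec_plus A `|` spec_minus A1))%E ->
     exists eps0 : R, [/\ 0 < eps0, eps0 <= 1 / rho &
       forall eps : R, 0 < eps -> eps < eps0 ->
         number_of_zeros (Delta A B rho eps) (cdisc lambda delta)
           (alg_mult A lambda)])
  /\
  (forall lambda : R[i], spec_minus A1 lambda ->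
     forall delta : R, 0 < delta ->
       (delta%:E <= disc_radius (spec_plus A `|` spec_minus A1))%E ->
     exists eps0 : R, [/\ 0 < eps0, eps0 <= 1 / rho &
       forall eps : R, 0 < eps -> eps < eps0 ->
         number_of_zeros (Delta A B rho eps) (cdisc lambda delta)
           (alg_mult A1 lambda)]).
Proof.
have rhoV : 0 < 1 / rho by rewrite divr_gt0.
set S := spec_plus A `|` spec_minus A1.
split=> lambda [lamA lam0] delta delta0 Hd.
- have Sl : S lambda by left.
  have d3 := disc_radius_Re Sl Hd.
  have dl : delta < `|complex.Re lambda|.
    by rewrite (lt_le_trans _ d3)// ltr_pMl// ltr1n.
  (* The separation concerns elements of [S] only. A root of [char_poly A] in the disc is one of
     them, because the disc lies in the right half plane. *)
  have uniq_root mu : root (char_poly (cmx A)) mu ->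
      `|mu - lambda| <= delta%:C -> mu = lambda.
    rewrite -spectrum_root => muA mul.
    apply: (disc_radius_unique delta0 Sl _ Hd mul).
    left; split=> //; have := Re_disc mul; rewrite ler_distl => /andP[+ _].
    by apply: lt_le_trans; rewrite subr_gt0 -(gtr0_norm lam0).
  have [e0 e0_gt0 He] := number_of_zeros_plus hrho delta0 d3 B lam0 uniq_root.
  exists (Num.min e0 (1 / rho)); split; first by rewrite lt_min e0_gt0.
    by rewrite ge_min lexx orbT.
  by move=> eps eps0; rewrite lt_min => /andP[epse _]; exact: He.
- have Sl : S lambda by right.
  have d3 := disc_radius_Re Sl Hd.
  have dl : delta < `|complex.Re lambda|.
    by rewrite (lt_le_trans _ d3)// ltr_pMl// ltr1n.
  have uniq_root mu : root (char_poly (cmx A1)) mu ->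
      `|mu - lambda| <= delta%:C -> mu = lambda.
    rewrite -spectrum_root => muA mul.
    apply: (disc_radius_unique delta0 Sl _ Hd mul).
    right; split=> //; have := Re_disc mul; rewrite ler_distl => /andP[_].
    by move/le_lt_trans; apply; rewrite -ltrBrDl sub0r -(ltr0_norm lam0).
  have [e0 e0_gt0 He] :=
    number_of_zeros_minus hrho delta0 d3 A2 A3 A4 lam0 hBbar uniq_root.
  exists (Num.min e0 (1 / rho)); split; first by rewrite lt_min e0_gt0.
    by rewrite ge_min lexx orbT.
  move=> eps eps0; rewrite lt_min => /andP[epse _].
  by rewrite hA hB; exact: He.
Qed.
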